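(* Suppose 2-sparse parity data in dimension $d\geq 2$, meaning the data distribution over $(x,y)$ has inputs supported on $H_d:=\{\pm1/\sqrt d\}^d$, and for any $x\in H_d$, the label is the product of two fixed coordinates, $y=d\,x_ax_b$ with $a\ne b$. 1. The distributional NTK margin condition holds with $\gamma_{\mathrm{ntk}}\ge\frac{1}{50d}$. 2. The distributional global margin condition holds with $\gamma_{\mathrm{gl}}\ge\frac{1}{\sqrt{8d}}$.
   Context: $\sigma(z)=\max\{0,z\}$. NTK margin condition on a finite sample $((x_i,y_i))_{i=1}^n$, with scalar $\gamma_{\mathrm{ntk}}>0$ and (measurable) map $\theta:\mathbb{R}^{d+1}\to\mathbb{R}^{d+1}$: $\|\theta(w)\|\le1$ for all $w$, $\theta(w)=0$ whenever $\|w\|\ge2$, and $$\min_i\ \mathbb{E}_{w\sim\mathcal{N}_\theta}\left\langle\theta(w),\bar\partial_wp_i(w)\right\rangle\ge\gamma_{\mathrm{ntk}},$$ where $w=(a,v)\in\mathbb{R}\times\mathbb{R}^d$, $w\sim\mathcal{N}_\theta$ means $a\sim N(0,1)$ and $v\sim N(0,I_d/d)$ independently, $p_i(w)=y_ia\,\sigma(v^{\top}x_i)$, and $\bar\partial$ is the minimum-norm element of the Clarke differential (almost surely the gradient $(y_i\sigma(v^{\top}x_i),\ y_ia\,\mathbf 1[v^{\top}x_i>0]\,x_i)$). The distributional NTK margin condition holds with $\gamma_{\mathrm{ntk}}$ if there is a single $\theta$ such that for every $n$ the finite-sample condition with this $\gamma_{\mathrm{ntk}}$ and $\theta$ holds almost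 surely for $n$ iid examples. Global margin condition on a finite sample with $\gamma_{\mathrm{gl}}>0$ and parameters $((\alpha_k,\beta_k))_{k=1}^r$, $\alpha_k\in\mathbb{R}$, $\|\alpha\|_1=1$, $\beta_k\in\mathbb{R}^d$, $\|\beta_k\|_2=1$: $\min_iy_i\sum_{k=1}^r\alpha_k\sigma(\beta_k^{\top}x_i)\ge\gamma_{\mathrm{gl}}$. The distributional global margin condition holds with $\gamma_{\mathrm{gl}}$ if there are fixed $((\alpha_k,\beta_k))_{k=1}^r$ such that for every $n$ the finite-sample condition with this $\gamma_{\mathrm{gl}}$ and these parameters holds almost surely for $n$ iid examples. *)

(* Defs.v *)
From HB Require Import structures.
From mathcomp Require Import all_boot all_order all_algebra.
From mathcomp Require Import all_classical all_reals all_analysis.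

Set Implicit Arguments.
Unset Strict Implicit.
Unset Printing Implicit Defensive.

Import Order.TTheory GRing.Theory Num.Theory.
Import numFieldNormedType.Exports.

Local Open Scope classical_set_scope.
Local Open Scope ring_scope.

(* 'rV[T]_n carries the sigma-algebra generated by the coordinate functions,
   which for T = R is the Borel sigma-algebra of R^n. *)
Definition measure_rV_display : measure_display -> measure_display.
Proof. exact. Qed.

Section measurable_rV.
Context {d} {T : measurableType d} (n : nat).

Definition rV_coord (j : 'I_n) (u : 'rV[T]_n) : T := u ord0 j.

Let rV_set0 : g_sigma_preimage rV_coord set0.
Proof. exact: sigma_algebra0. Qed.

Let rV_setC A : g_sigma_preimage rV_coord A -> g_sigma_preimage rV_coord (~` A).
Proof. exact: sigma_algebraC. Qed.

Let rV_bigcup (F : _^nat) : (forall i, g_sigma_preimage rV_coord (F i)) ->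
  g_sigma_preimage rV_coord (\bigcup_i (F i)).
Proof. exact: sigma_algebra_bigcup. Qed.

HB.instance Definition _ := @isMeasurable.Build (measure_rV_display d)
  'rV[T]_n (g_sigma_preimage rV_coord) rV_set0 rV_setC rV_bigcup.

End measurable_rV.

Section normal_law.
Context {R : realType}.

(* normal_prob is a measure on measurableTypeR R, which has the same measurable
   sets as R but is a different measurableType; it is transported to R along
   the identity.  As for normal_prob, s is the standard deviation. *)
Definition of_measurableTypeR (x : measurableTypeR R) : R := x.

Let measurable_of_measurableTypeR : measurable_fun setT of_measurableTypeR.
Proof. by move=> _ Y mY; rewrite setTI. Qed.

HB.instance Definition _ := isMeasurableFun.Build _ _ _ _
  of_measurableTypeR measurable_of_measurableTypeR.

Definition normal_law (m s : R) : probability R R :=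
  distribution (normal_prob m s) of_measurableTypeR.

End normal_law.

Section iid_law.
Context {d} {T : measurableType d} {R : realType}.

Definition tuple_cons n (z : T * n.-tuple T) : n.+1.-tuple T :=
  [tuple of z.1 :: z.2].

Let measurable_tuple_cons n : measurable_fun [set: T * n.-tuple T] (@tuple_cons n).
Proof. exact: measurable_cons. Qed.

HB.instance Definition _ n :=
  isMeasurableFun.Build _ _ _ _ (@tuple_cons n) (@measurable_tuple_cons n).

(* The n-fold product measure, i.e. the joint law of n iid draws from P. *)
Fixpoint iid_law (P : probability T R) n : probability (n.-tuple T) R :=
  match n with
  | 0 => @dirac _ _ [tuple] R
  | m.+1 => distribution (P \x iid_law P m)%E (@tuple_cons m)
  end.

Definition row_of_tuple n (t : n.-tuple T) : 'rV[T]_n := \row_j tnth t j.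

Let measurable_row_of_tuple n :
  measurable_fun [set: n.-tuple T] (@row_of_tuple n).
Proof.
move=> _ Y mY; rewrite setTI.
have : image_set_system setT (@row_of_tuple n) measurable Y.
  apply: smallest_sub mY; first exact/sigma_algebra_image/sigma_algebra_measurable.
  case: n Y => [|n] Y; first by rewrite big_ord0.
  rewrite -bigcup_mkord_ord; apply: bigcup_sub => i Ii _ [B mB <-].
  rewrite /image_set_system/= !setTI.
  rewrite (_ : _ @^-1` _ = (@tnth _ T ^~ (inord i)) @^-1` B).
    rewrite -[X in measurable X]setTI.
    exact: (measurable_tnth (inord i) measurableT).
  by apply/seteqP; split => t /=; rewrite /rV_coord mxE.
by rewrite /image_set_system/= setTI.
Qed.

HB.instance Definition _ n :=
  isMeasurableFun.Build _ _ _ _ (@row_of_tuple n) (@measurable_row_of_tuple n).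

End iid_law.

Section euclidean.
Context {R : realType} {d : nat}.

Definition dot (u v : 'rV[R]_d) : R := \sum_j u ord0 j * v ord0 j.

Definition norm2 (u : 'rV[R]_d) : R := Num.sqrt (dot u u).

(* R^(d+1) is represented as R * R^d, so that w = (a, v).  The canonical norms
   on row vectors and pairs are sup norms, hence the explicit Euclidean
   structure. *)
Definition pdot (w z : R * 'rV[R]_d) : R := w.1 * z.1 + dot w.2 z.2.

Definition pnorm2 (w : R * 'rV[R]_d) : R := Num.sqrt (pdot w w).

End euclidean.

Definition convex_hull {R : realType} {V : lmodType R} (A : set V) : set V :=
  [set z | exists m (l : 'I_m -> R) (p : 'I_m -> V),
    [/\ forall i, 0 <= l i, \sum_i l i = 1, forall i, A (p i)
      & z = \sum_i l i *: p i]].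

Section clarke.
Context {R : realType} {d : nat}.
Implicit Types (f : R * 'rV[R]_d -> R^o) (w g : R * 'rV[R]_d).

Definition is_gradient f w g :=
  differentiable f w /\ forall h, 'd f w h = pdot g h.

Definition clarke_differential f w : set (R * 'rV[R]_d) :=
  convex_hull [set g : R * 'rV[R]_d | exists u G : nat -> R * 'rV[R]_d,
    [/\ u @ \oo --> w, forall k, is_gradient f (u k) (G k) & G @ \oo --> g]].

(* The minimum-norm element of the Clarke differential; it exists and is unique
   for locally Lipschitz f, and the default value 0 is used otherwise. *)
Definition clarke_min_grad f w : R * 'rV[R]_d :=
  xget 0 [set g | clarke_differential f w g /\
    forall h, clarke_differential f w h -> pnorm2 g <= pnorm2 h].

End clarke.

Section margins.
Context {R : realType} {d : nat}.

Definition relu (z : R) : R := Num.max 0 z.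

(* The second factor is the law N(0, I_d / d). *)
Definition init_law : probability (R * 'rV[R]_d)%type R :=
  (normal_law 0 1 \x
    distribution (iid_law (normal_law 0 (Num.sqrt d%:R)^-1) d)
      (@row_of_tuple _ _ d))%E.

(* An example is a pair (x, y) of an input and a label. *)
Definition node_margin (e : 'rV[R]_d * R) (w : R * 'rV[R]_d) : R^o :=
  e.2 * w.1 * relu (dot w.2 e.1).

Definition ntk_margin n (S : n.-tuple ('rV[R]_d * R)) (gamma : R)
    (theta : R * 'rV[R]_d -> R * 'rV[R]_d) : Prop :=
  [/\ 0 < gamma,
      measurable_fun setT theta,
      forall w, pnorm2 (theta w) <= 1,
      forall w, 2 <= pnorm2 w -> theta w = 0
    & forall i : 'I_n, (gamma%:E <=
        'E_init_law[fun w =>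
          pdot (theta w) (clarke_min_grad (node_margin (tnth S i)) w)])%E].

Definition dist_ntk_margin (D : probability ('rV[R]_d * R)%type R)
    (gamma : R) : Prop :=
  exists theta, forall n,
    {ae iid_law D n, forall S, ntk_margin S gamma theta}.

Definition global_margin n (S : n.-tuple ('rV[R]_d * R)) (gamma : R)
    r (alpha : 'I_r -> R) (beta : 'I_r -> 'rV[R]_d) : Prop :=
  [/\ 0 < gamma,
      \sum_k `|alpha k| = 1,
      forall k, norm2 (beta k) = 1
    & forall i : 'I_n, gamma <=
        (tnth S i).2 * \sum_k alpha k * relu (dot (beta k) (tnth S i).1)].

Definition dist_global_margin (D : probability ('rV[R]_d * R)%type R)
    (gamma : R) : Prop :=
  exists r (alpha : 'I_r -> R) (beta : 'I_r -> 'rV[R]_d), forall n,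
    {ae iid_law D n, forall S, global_margin S gamma alpha beta}.

Definition hypercube : set 'rV[R]_d :=
  [set x | forall j, x ord0 j = (Num.sqrt d%:R)^-1 \/
                     x ord0 j = - (Num.sqrt d%:R)^-1].

Definition parity_data (a b : 'I_d) (D : probability ('rV[R]_d * R)%type R) :=
  {ae D, forall e, hypercube e.1 /\ e.2 = d%:R * e.1 ord0 a * e.1 ord0 b}.

End margins.

(* Main.v *)
Require Import Defs.
From HB Require Import structures.
From mathcomp Require Import all_boot all_order all_algebra.
From mathcomp Require Import all_classical all_reals all_analysis.
From mathcomp Require Import measurable_realfun.
From mathcomp Require Import ring lra.
Import Order.TTheory GRing.Theory Num.Theory.
Import numFieldNormedType.Exports.
Local Open Scope classical_set_scope.
Local Open Scope ring_scope.

(**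
For the global margin, [|x_a + x_b| - |x_a - x_b|] is [2 / sqrt d] times the
label, and each absolute value is a sum of two ReLUs.

For the NTK margin, take
  [theta (alpha, v) = (0, [|alpha| <= 1] [|v|^2 < 3] sg alpha * sg v_b * e_a)].
The minimum-norm Clarke gradient at [(alpha, v)] is
[(y relu (v.x), [0 < v.x] y alpha x)] everywhere, including at [v.x = 0]
where [0] belongs to the Clarke differential.  After flipping the coordinates
of [v] by the signs of [x], the margin of every example is
[E (|alpha| [|alpha| <= 1]) / sqrt d] times
[E (sg v_b [0 < S] [|v|^2 < 3])], with [S] the sum of the coordinates of [v];
reflecting [v_b] turns the second factor into the probability [P0] of
[0 < u, - u < T <= u, |v|^2 < 3], with [u = v_b] and [T = S - u].  Without the
truncation this is the probability [K] of a cone, and [K >= c / sqrt d] because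
[T] is Gaussian.  The truncation costs a constant factor only: with
[tau = exp (- 1 / 10)], the bound
[exp (- q / 10) <= tau ^+ 3 + (1 - tau ^+ 3) [q < 3]] at [q = |v|^2] gives
[E ([cone] exp (- |v|^2 / 10)) <= tau ^+ 3 * K + (1 - tau ^+ 3) * P0], and the
left-hand side is at least [tau * K] since the exponential weight amounts to a
rescaling of the Gaussian, which preserves the cone.
*)

(** * Gaussian measures on the line *)

Section lebesgue_affine.
Context {R : realType}.
Local Open Scope ereal_scope.
Local Notation mu := (@lebesgue_measure R).

Definition affine (k c : R) (x : R) : measurableTypeR R := (k * x + c)%R.

Lemma measurable_affine k c : measurable_fun [set: measurableTypeR R] (affine k c).
Proof.
have H : measurable_fun [set: R] (fun x : R => (k * x + c)%R).
  by apply: measurable_funD => //; apply: measurable_funM.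
exact: H.
Qed.

HB.instance Definition _ k c :=
  isMeasurableFun.Build _ _ _ _ (affine k c) (measurable_affine k c).

(** Lebesgue measure is determined by its values on the intervals []a, b]], and the preimage of such
    an interval under [affine k c] has length [(b - a) / k]. *)
Lemma lebesgue_measure_affine (k c : R) (k0 : (0 < k)%R) (A : set R) :
  measurable A ->
  mu A = k%:E * pushforward mu (affine k c) A.
Proof.
move=> mA; have mphi := measurable_affine k c.
rewrite (@lebesgue_measure_unique _
  (mscale (NngNum (ltW k0)) (pushforward mu (affine k c)))) => //= _ [[a b]] _ <-.
rewrite /mscale/= /pushforward.
have -> : affine k c @^-1` `]a, b]%classic = `]((a - c) / k)%R, ((b - c) / k)%R]%classic.
  apply/seteqP; split => x /=; rewrite !in_itv /affine/=;
    rewrite ltr_pdivrMr// ler_pdivlMr// => /andP[? ?]; apply/andP; split; lra.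
rewrite !lebesgue_measure_itv/= !lte_fin ltr_pM2r ?invr_gt0// ltrD2r.
case: ifP => // ab; last by rewrite mule0.
by rewrite -!EFinB -EFinM; congr EFin; field; rewrite gt_eqF.
Qed.

Lemma ge0_integral_lebesgue_affine (k c : R) (f : R -> \bar R) : (0 < k)%R ->
  measurable_fun [set: R] f -> (forall x, 0 <= f x) ->
  \int[mu]_x f x = k%:E * \int[mu]_x f (k * x + c)%R.
Proof.
move=> k0 mf f0; have mphi := measurable_affine k c.
rewrite (@eq_measure_integral _ _ _ setT
    (mscale (NngNum (ltW k0)) (pushforward mu (affine k c)))) //; last first.
  by move=> A mA _; exact: lebesgue_measure_affine.
by rewrite ge0_integral_mscale// ge0_integral_pushforward.
Qed.

Lemma ge0_integral_lebesgueN (f : R -> \bar R) :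
  measurable_fun [set: R] f -> (forall x, 0 <= f x) ->
  \int[mu]_x f (- x)%R = \int[mu]_x f x.
Proof.
move=> mf f0.
pose phi : measurableTypeR R -> measurableTypeR R := fun x => (- x)%R.
have mphi : measurable_fun [set: measurableTypeR R] phi.
  have H : measurable_fun [set: R] (-%R : R -> R) by [].
  exact: H.
transitivity (\int[pushforward mu phi]_x f x).
  by rewrite ge0_integral_pushforward.
by apply: eq_measure_integral => A mA _; exact: lebesgue_measureN.
Qed.

End lebesgue_affine.

Section normal_law.
Context {R : realType}.
Local Open Scope ereal_scope.
Local Notation mu := (@lebesgue_measure R).
Import HBNNSimple.

(** First stage of the density formula. A simple function is a finite sum over its values, and on
    each level set [normal_prob] is by definition the integral of the density. *)
Let integral_normal_prob_nnsfun (m s : R) (g : {nnsfun (measurableTypeR R) >-> R}) :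
  \int[normal_prob m s]_x (g x)%:E = \int[mu]_x ((g x)%:E * (normal_pdf m s x)%:E).
Proof.
have mp : measurable_fun [set: measurableTypeR R] (fun x => (normal_pdf m s x)%:E).
  by apply/measurable_EFinP; exact: measurable_normal_pdf.
under eq_integral do rewrite fimfunE -fsumEFin//.
rewrite ge0_integral_fsum//; last 2 first.
- by move=> r; exact/measurable_EFinP/measurable_funM.
- by move=> r x _; rewrite nnfun_muleindic_ge0.
transitivity (\sum_(r \in range g)
    \int[mu]_x ((r * \1_(g @^-1` [set r]) x)%:E * (normal_pdf m s x)%:E)).
  apply: eq_fsbigr => r _.
  rewrite integralZl_indic_nnsfun// integral_indic// setIT.
  have [r0|r0] := ltP r 0%R.
    rewrite preimage_nnfun0// measure0 mule0 integral0_eq// => x _.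
    by rewrite indic0 mulr0 mul0e.
  under [RHS]eq_integral do rewrite EFinM -muleA.
  rewrite ge0_integralZl//; last 2 first.
  - by apply: emeasurable_funM => //; exact/measurable_EFinP.
  - by move=> x _; rewrite -EFinM lee_fin mulr_ge0// normal_pdf_ge0.
  congr (_ * _); rewrite /normal_prob [LHS]integral_mkcond.
  apply: eq_integral => x _; rewrite patchE indicE.
  by case: ifP => _; rewrite ?mul1e ?mul0e.
rewrite -ge0_integral_fsum//.
- apply: eq_integral => x _; rewrite [in RHS]fimfunE -fsumEFin//.
  rewrite ge0_mule_fsuml// => r.
  by rewrite nnfun_muleindic_ge0.
- move=> r; apply: emeasurable_funM => //.
  exact/measurable_EFinP/measurable_funM.
- by move=> r x _; rewrite mule_ge0 ?nnfun_muleindic_ge0// lee_fin normal_pdf_ge0.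
Qed.

(** Monotone convergence along simple approximations of [f], on both sides; multiplying by the
    nonnegative density preserves monotonicity. *)
Let ge0_integral_normal_prob (m s : R) (f : measurableTypeR R -> \bar R) :
  measurable_fun setT f -> (forall x, 0 <= f x) ->
  \int[normal_prob m s]_x f x = \int[mu]_x (f x * (normal_pdf m s x)%:E).
Proof.
move=> mf f0; pose g := nnsfun_approx measurableT mf.
have mp : measurable_fun [set: measurableTypeR R] (fun x => (normal_pdf m s x)%:E).
  by apply/measurable_EFinP; exact: measurable_normal_pdf.
transitivity (limn (fun n => \int[normal_prob m s]_x (g n x)%:E)).
  rewrite -monotone_convergence//=.
  - apply: eq_integral => x _; apply/esym/cvg_lim => //=.
    exact: cvg_nnsfun_approx.
  - by move=> n; exact/measurable_EFinP.
  - by move=> n x _; rewrite lee_fin.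
  - by move=> x _ a b ab; rewrite lee_fin; exact/lefP/nd_nnsfun_approx.
under eq_fun do rewrite integral_normal_prob_nnsfun.
rewrite -monotone_convergence//=.
- apply: eq_integral => x _; apply/cvg_lim => //=.
  by apply: cvgeZr => //; exact: cvg_nnsfun_approx.
- by move=> n; apply: emeasurable_funM => //; exact/measurable_EFinP.
- by move=> n x _; rewrite mule_ge0// lee_fin ?normal_pdf_ge0.
- move=> x _ a b ab; rewrite lee_wpmul2r ?lee_fin ?normal_pdf_ge0//.
  exact/lefP/nd_nnsfun_approx.
Qed.

Lemma ge0_integral_normal_law (m s : R) (f : R -> \bar R) :
  measurable_fun [set: R] f -> (forall x, 0 <= f x) ->
  \int[normal_law m s]_x f x = \int[mu]_x (f x * (normal_pdf m s x)%:E).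
Proof.
move=> mf f0; rewrite ge0_integral_distribution//.
rewrite (ge0_integral_normal_prob m s (f \o of_measurableTypeR))//.
Qed.

Lemma normal_pdf0E (s x : R) : s != 0%R ->
  normal_pdf 0 s x = (normal_peak s * expR (- (x ^+ 2 / (s ^+ 2 *+ 2))))%R.
Proof. by move=> s0; rewrite normal_pdfE// /normal_fun subr0 mulNr. Qed.

Lemma normal_peakE (s : R) : (0 < s)%R ->
  normal_peak s = (s^-1 * (Num.sqrt (pi *+ 2))^-1)%R.
Proof.
by move=> s0; rewrite /normal_peak -mulrnAr sqrtrM ?sqr_ge0// sqrtr_sqr gtr0_norm// invfM.
Qed.

Lemma measurable_normal_pdf_EFin (m s : R) :
  measurable_fun [set: R] (fun x => (normal_pdf m s x)%:E).
Proof.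
have H : measurable_fun [set: measurableTypeR R] (fun x => (normal_pdf m s x)%:E).
  by apply/measurable_EFinP; exact: measurable_normal_pdf.
exact: H.
Qed.

Lemma ge0_integral_normal_lawN (s : R) (f : R -> \bar R) : s != 0%R ->
  measurable_fun [set: R] f -> (forall x, 0 <= f x) ->
  \int[normal_law 0 s]_x f (- x)%R = \int[normal_law 0 s]_x f x.
Proof.
move=> s0 mf f0; rewrite !ge0_integral_normal_law//; last first.
  exact: measurableT_comp.
transitivity (\int[mu]_x (f (- x)%R * (normal_pdf 0 s (- x))%:E)); last first.
  apply: (ge0_integral_lebesgueN (fun x => f x * (normal_pdf 0 s x)%:E)).
- by apply: emeasurable_funM => //; exact: measurable_normal_pdf_EFin.
- by move=> x; rewrite mule_ge0// lee_fin normal_pdf_ge0.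
by apply: eq_integral => x _; rewrite !normal_pdf0E// sqrrN.
Qed.

(* The Gaussian density multiplied by [exp (- l * x ^+ 2)] is, up to the factor
   [k], the density of [k] times the original Gaussian. *)
Lemma ge0_integral_normal_law_tilt (s k l : R) (f : R -> \bar R) :
  (0 < s)%R -> (0 < k)%R -> (k ^+ 2 * (1 + 2 * l * s ^+ 2) = 1)%R ->
  measurable_fun [set: R] f -> (forall x, 0 <= f x) ->
  \int[normal_law 0 s]_x (f x * (expR (- (l * x ^+ 2)))%:E) =
  k%:E * \int[normal_law 0 s]_x f (k * x)%R.
Proof.
move=> s0 k0 kl mf f0; have sn0 : s != 0%R by rewrite gt_eqF.
have me : measurable_fun [set: R] (fun x => (expR (- (l * x ^+ 2)))%:E).
  apply/measurable_EFinP; apply: measurableT_comp => //.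
  by apply: measurableT_comp => //; apply: measurable_funM => //; exact: measurable_funX.
have mk : measurable_fun [set: R] (fun x => f (k * x)%R).
  by apply: measurableT_comp => //; exact: measurable_funM.
rewrite !ge0_integral_normal_law//; last 2 first.
- exact: emeasurable_funM.
- by move=> x; rewrite mule_ge0// lee_fin expR_ge0.
pose g (x : R) := f x * (expR (- (l * x ^+ 2)))%:E * (normal_pdf 0 s x)%:E.
have mg : measurable_fun [set: R] g.
  apply: emeasurable_funM; last exact: measurable_normal_pdf_EFin.
  exact: emeasurable_funM.
have g0 x : 0 <= g x by rewrite !mule_ge0// lee_fin ?normal_pdf_ge0 ?expR_ge0.
apply: etrans; first exact: (ge0_integral_lebesgue_affine k 0 g k0 mg g0).
rewrite /g; congr (_ * _); apply: eq_integral => x _; rewrite addr0 -muleA; congr (_ * _).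
rewrite -EFinM !normal_pdf0E// mulrCA -expRD; congr (_ * expR _)%:E.
rewrite exprMn.
(* For this value of [k ^+ 2] the exponents [l k^2 x^2] and [k^2 x^2 / (2 s^2)] add up to
   [x^2 / (2 s^2)]. *)
have -> : (k ^+ 2 = (1 + 2 * l * s ^+ 2)^-1)%R.
  have h : (1 + 2 * l * s ^+ 2 != 0)%R.
    by apply/eqP => h; move: kl; rewrite h mulr0 => /esym/eqP; rewrite oner_eq0.
  by apply: (mulIf h); rewrite kl mulVf.
have h : (1 + 2 * l * s ^+ 2 != 0)%R.
  by apply/eqP => h; move: kl; rewrite h mulr0 => /esym/eqP; rewrite oner_eq0.
by field; rewrite h sn0.
Qed.

(* The square is completed in [y]. *)
Lemma normal_pdf_mul (s t r x y : R) :
  (0 < s)%R -> (0 < t)%R -> (0 < r)%R -> (r ^+ 2 = s ^+ 2 + t ^+ 2)%R ->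
  (normal_pdf 0 s (x - y) * normal_pdf 0 t y =
   normal_pdf 0 r x * normal_pdf (x * t ^+ 2 / r ^+ 2) (s * t / r) y)%R.
Proof.
move=> s0 t0 r0 rst.
have str0 : (0 < s * t / r)%R by rewrite !mulr_gt0// invr_gt0.
have [sn0 tn0 rn0 strn0] : [/\ s != 0, t != 0, r != 0 & s * t / r != 0]%R.
  by rewrite !gt_eqF.
rewrite !normal_pdf0E// normal_pdfE// /normal_fun !normal_peakE//.
rewrite mulrACA [RHS]mulrACA -!expRD; congr (_ * expR _)%R.
  have c0 : Num.sqrt (pi *+ 2 : R) != 0%R.
    by rewrite gt_eqF// sqrtr_gt0 mulrn_wgt0// pi_gt0.
  by field; rewrite c0 sn0 tn0 rn0.
have q0 : (s ^+ 2 + t ^+ 2 != 0)%R by rewrite -rst expf_neq0.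
by rewrite !exprMn exprVn rst; field; rewrite sn0 tn0 q0.
Qed.

(** The sum of two independent centred Gaussians is Gaussian. After the translation by [y] and
    Tonelli, [normal_pdf_mul] splits the product of densities into the density of the sum at [x] and
    a normal density in [y], which integrates to [1]. *)
Lemma ge0_integral_normal_lawD (s t r : R) (f : R -> \bar R) :
  (0 < s)%R -> (0 < t)%R -> (0 < r)%R -> (r ^+ 2 = s ^+ 2 + t ^+ 2)%R ->
  measurable_fun [set: R] f -> (forall x, 0 <= f x) ->
  \int[normal_law 0 t]_y \int[normal_law 0 s]_x f (y + x)%R =
  \int[normal_law 0 r]_x f x.
Proof.
move=> s0 t0 r0 rst mf f0.
have sn0 : s != 0%R by rewrite gt_eqF.
have tn0 : t != 0%R by rewrite gt_eqF.
have rn0 : r != 0%R by rewrite gt_eqF.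
pose h (z : R * measurableTypeR R) := f z.2 * (normal_pdf 0 s (z.2 - z.1))%:E.
have mh : measurable_fun setT h.
  have H : measurable_fun [set: R * R]
      (fun z : R * R => f z.2 * (normal_pdf 0 s (z.2 - z.1))%:E).
    apply: emeasurable_funM; first exact: measurableT_comp.
    apply: (measurableT_comp (measurable_normal_pdf_EFin 0 s)).
    exact: measurable_funB.
  exact: H.
have h0 z : 0 <= h z by rewrite mule_ge0// lee_fin normal_pdf_ge0.
transitivity (\int[normal_law 0 t]_y \int[mu]_x h (y, x)).
  apply: eq_integral => y _.
  have mfy : measurable_fun [set: R] (fun x => f (y + x)%R).
    by apply: measurableT_comp => //; exact: measurable_funD.
  apply: etrans; first exact: (ge0_integral_normal_law 0 s _ mfy).
  have mhy : measurable_fun [set: R]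
      (fun x : R => f x * (normal_pdf 0 s (x - y))%:E).
    apply: emeasurable_funM => //.
    apply: (measurableT_comp (measurable_normal_pdf_EFin 0 s)).
    exact: measurable_funB.
  apply: esym; apply: etrans.
    apply: (ge0_integral_lebesgue_affine 1 y _ ltr01 mhy) => x.
    by rewrite mule_ge0// lee_fin normal_pdf_ge0.
  by rewrite mul1e; apply: eq_integral => x _; rewrite /h/= mul1r addrK addrC.
rewrite fubini_tonelli//.
apply: esym; apply: etrans; first exact: ge0_integral_normal_law.
apply: eq_integral => x _; rewrite /h/=; apply: esym.
rewrite ge0_integralZl//; last 2 first.
- apply: (measurableT_comp (measurable_normal_pdf_EFin 0 s)).
  exact: measurable_funB.
- by move=> y _; rewrite lee_fin normal_pdf_ge0.
congr (_ * _).
have msx : measurable_fun [set: R] (fun y => (normal_pdf 0 s (x - y))%:E).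
  apply: (measurableT_comp (measurable_normal_pdf_EFin 0 s)).
  exact: measurable_funB.
apply: etrans.
  by apply: (ge0_integral_normal_law 0 t _ msx) => y; rewrite lee_fin normal_pdf_ge0.
under eq_integral do rewrite -EFinM (normal_pdf_mul _ _ _ _ _ s0 t0 r0 rst) EFinM.
rewrite ge0_integralZl//.
- by rewrite integral_normal_pdf mule1.
- exact: measurable_normal_pdf_EFin.
- by move=> y _; rewrite lee_fin normal_pdf_ge0.
- by rewrite lee_fin normal_pdf_ge0.
Qed.

End normal_law.

(** * Product measures *)

Section iid_integral.
Context {d} {T : measurableType d} {R : realType} (P : probability T R).
Local Open Scope ereal_scope.

Lemma ge0_integral_iid0 (F : 0.-tuple T -> \bar R) :
  measurable_fun setT F -> \int[iid_law P 0]_t F t = F [tuple].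
Proof.
move=> mF; rewrite integral_dirac// diracT mul1e//.
Qed.

Lemma measurable_tuple_cons_pair n :
  measurable_fun [set: T * n.-tuple T] (@tuple_cons _ T n).
Proof. exact: measurable_funPT. Qed.

Lemma measurable_tuple_consr n (x : T) :
  measurable_fun [set: n.-tuple T] (fun t => tuple_cons (x, t)).
Proof. exact: (measurableT_comp (@measurable_tuple_cons_pair n)). Qed.

Lemma ge0_integral_iidS n (F : n.+1.-tuple T -> \bar R) :
  measurable_fun setT F -> (forall t, 0 <= F t) ->
  \int[iid_law P n.+1]_t F t = \int[P]_x \int[iid_law P n]_t F (tuple_cons (x, t)).
Proof.
move=> mF F0; rewrite ge0_integral_distribution//.
rewrite (fubini_tonelli1 (F \o @tuple_cons _ T n))//=.
by apply: measurableT_comp => //; exact: measurable_tuple_cons_pair.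
Qed.

(** Induction on [n]: the exceptional set is the union of the cylinder where the head lies in [N]
    and the one where the tail lies in [M], and each is a product with a null factor. *)
Lemma ae_iid_law n (Q : T -> Prop) : {ae P, forall x, Q x} ->
  {ae iid_law P n, forall S : n.-tuple T, forall i, Q (tnth S i)}.
Proof.
move=> [N [mN N0 sN]]; elim: n => [|n [M [mM M0 sM]]].
  by exists set0; split => // S /= h; exfalso; apply: h => -[].
pose A := (fun t : n.+1.-tuple T => tnth t ord0) @^-1` N.
pose B := (fun t : n.+1.-tuple T => [tuple of behead t]) @^-1` M.
have mA : measurable A.
  by rewrite -[A]setTI; exact: (measurable_tnth ord0 measurableT).
have mB : measurable B by rewrite -[B]setTI; exact: measurable_behead.
exists (A `|` B); split; first exact: measurableU.
- apply/eqP; rewrite -measure_le0; apply: le_trans (measureU2 _ mA mB) _.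
  rewrite /= /distribution/= /pushforward.
  have -> : @tuple_cons _ T n @^-1` A = N `*` setT.
    by apply/seteqP; split => [[x t]|[x t] []].
  have -> : @tuple_cons _ T n @^-1` B = setT `*` M.
    apply/seteqP; split => [[x t]|[x t]].
      rewrite /B/= => Mt; split => //=; congr M : Mt; exact/val_inj.
    rewrite /B/= => -[_ Mt]; congr M : Mt; exact/val_inj.
  rewrite !product_measure1E//= N0 M0 mul0e mule0 adde0//.
- move=> S /= /existsNP[i nQ]; have [i0|i0] := eqVneq i ord0.
    by left; apply: sN; rewrite /= -i0.
  right; apply: sM => /= h; apply: nQ.
  case: (unliftP ord0 i) => [j ->|/eqP]; last by rewrite (negbTE i0).
  move: (h j); rewrite tnth_behead (_ : inord j.+1 = lift ord0 j)//.
  by apply: val_inj; rewrite /= inordK// ltnS.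
Qed.

End iid_integral.

(** * Exchangeability and sign symmetry of iid real samples *)

Section real_iid.
Context {R : realType}.
Local Open Scope ereal_scope.

(** Together with one coordinate, [tsum] and [tsq] are the only statistics of the Gaussian vector
    that the NTK integrand involves after the sign flips. *)
Definition tsum n (t : n.-tuple R) : R := \sum_(j < n) tnth t j.
Definition tsq n (t : n.-tuple R) : R := \sum_(j < n) (tnth t j) ^+ 2.

Lemma tsum_cons n x (t : n.-tuple R) : tsum _ (tuple_cons (x, t)) = (x + tsum _ t)%R.
Proof.
rewrite /tsum big_ord_recl/= tnth0; congr (_ + _)%R.
by apply: eq_bigr => i _; rewrite tnthS.
Qed.

Lemma tsq_cons n x (t : n.-tuple R) :
  tsq _ (tuple_cons (x, t)) = (x ^+ 2 + tsq _ t)%R.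
Proof.
rewrite /tsq big_ord_recl/= tnth0; congr (_ + _)%R.
by apply: eq_bigr => i _; rewrite tnthS.
Qed.

Lemma measurable_tsum n : measurable_fun setT (@tsum n).
Proof. by apply: measurable_sum => i; exact: measurable_tnth. Qed.

Lemma measurable_tsq n : measurable_fun setT (@tsq n).
Proof.
by apply: measurable_sum => i; apply: measurable_funX; exact: measurable_tnth.
Qed.

HB.instance Definition _ n :=
  isMeasurableFun.Build _ _ _ _ (tsum n) (@measurable_tsum n).
HB.instance Definition _ n :=
  isMeasurableFun.Build _ _ _ _ (tsq n) (@measurable_tsq n).

Variable P : probability R R.

(** Any coordinate of an iid sample may be integrated first. If [b] lies in the tail, the induction
    hypothesis moves it to the front of the tail, and Tonelli then exchanges it with the head. *)
Lemma ge0_integral_iid_extract n (b : 'I_n.+1) (f : R * (R * R) -> \bar R) :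
  measurable_fun setT f -> (forall z, 0 <= f z) ->
  \int[iid_law P n.+1]_t f (tnth t b, (tsum _ t, tsq _ t)) =
  \int[P]_u \int[iid_law P n]_t f (u, (u + tsum _ t, u ^+ 2 + tsq _ t))%R.
Proof.
have mfS k (j : 'I_k) (g : R * (R * R) -> \bar R) : measurable_fun setT g ->
    measurable_fun setT (fun t : k.-tuple R => g (tnth t j, (tsum _ t, tsq _ t))).
  move=> mg; apply: measurableT_comp => //.
  apply: measurable_fun_pair; first exact: measurable_tnth.
  exact: measurable_fun_pair.
elim: n b f => [|n IH] b f mf f0.
  apply: etrans.
    by apply: ge0_integral_iidS => [|t]; [exact: mfS|exact: f0].
  apply: eq_integral => u _; apply: eq_integral => t _.
  by rewrite tsum_cons tsq_cons ord1 tnth0.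
apply: etrans.
  by apply: ge0_integral_iidS => [|t]; [exact: mfS|exact: f0].
case: (unliftP ord0 b) => [b' ->|->]; last first.
  apply: eq_integral => u _; apply: eq_integral => t _.
  by rewrite tsum_cons tsq_cons tnth0.
pose g (z : (R * R) * n.-tuple R) := f (z.1.2,
  (z.1.2 + (z.1.1 + tsum _ z.2), z.1.2 ^+ 2 + (z.1.1 ^+ 2 + tsq _ z.2)))%R.
have mg : measurable_fun setT g.
  apply: measurableT_comp => //; apply: measurable_fun_pair.
    exact: measurableT_comp.
  apply: measurable_fun_pair; apply: measurable_funD.
  - exact: measurableT_comp.
  - apply: measurable_funD; first exact: measurableT_comp.
    exact: measurableT_comp.
  - by apply: measurable_funX; exact: measurableT_comp.
  - apply: measurable_funD; first by apply: measurable_funX; exact: measurableT_comp.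
    exact: measurableT_comp.
have g0 z : 0 <= g z by exact: f0.
transitivity (\int[P]_x \int[P]_u \int[iid_law P n]_t g ((x, u), t)).
  apply: eq_integral => x _.
  (* With the head [x] frozen, its contributions to the sum and to the sum of squares are absorbed
     into the integrand, so that the induction hypothesis applies to the tail. *)
  pose f' (z : R * (R * R)) := f (z.1, (x + z.2.1, x ^+ 2 + z.2.2))%R.
  have mf' : measurable_fun setT f'.
    apply: measurableT_comp => //; apply: measurable_fun_pair => //.
    by apply: measurable_fun_pair; apply: measurable_funD => //; exact: measurableT_comp.
  transitivity (\int[iid_law P n.+1]_t f' (tnth t b', (tsum _ t, tsq _ t))).
    by apply: eq_integral => t _; rewrite tsum_cons tsq_cons tnthS.
  have f'0 z : 0 <= f' z by exact: f0.
  rewrite (IH b' f' mf' f'0).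
  apply: eq_integral => u _; apply: eq_integral => t _.
  by rewrite /f' /g/= ![(x + (u + _))%R]addrCA ![(x ^+ 2 + (u ^+ 2 + _))%R]addrCA.
have mG : measurable_fun setT (fun z => \int[iid_law P n]_t g (z, t)).
  exact: measurable_fun_fubini_tonelli_F.
have G0 z : 0 <= \int[iid_law P n]_t g (z, t) by exact: integral_ge0.
rewrite (fubini_tonelli (fun z => \int[iid_law P n]_t g (z, t)) mG G0).
apply: eq_integral => u _; apply/esym; apply: etrans.
  apply: ge0_integral_iidS => //; apply: measurableT_comp => //.
  apply: measurable_fun_pair => //.
  by apply: measurable_fun_pair; apply: measurable_funD.
by apply: eq_integral => x _; apply: eq_integral => t _; rewrite tsum_cons tsq_cons.
Qed.

Definition tflip n (e : 'I_n -> bool) (t : n.-tuple R) : n.-tuple R :=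
  [tuple (-1) ^+ e j * tnth t j | j < n]%R.

Lemma measurable_tflip n (e : 'I_n -> bool) : measurable_fun setT (tflip n e).
Proof.
apply/measurable_fun_tnthP => i.
rewrite (_ : _ \o _ = fun t => (-1) ^+ e i * tnth t i)%R; last first.
  by apply/funext => t /=; rewrite tnth_mktuple.
by apply: measurable_funM => //; exact: measurable_tnth.
Qed.

(** The symmetry of [P] absorbs the sign of the head; the induction hypothesis absorbs those of the
    tail. *)
Lemma ge0_integral_iid_flip n (e : 'I_n -> bool) (F : n.-tuple R -> \bar R) :
  (forall f : R -> \bar R, measurable_fun [set: R] f -> (forall x, 0 <= f x) ->
    \int[P]_x f (- x)%R = \int[P]_x f x) ->
  measurable_fun setT F -> (forall t, 0 <= F t) ->
  \int[iid_law P n]_t F (tflip n e t) = \int[iid_law P n]_t F t.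
Proof.
move=> Psym; elim: n e F => [|n IH] e F mF F0.
  by apply: eq_integral => t _; rewrite (tuple0 t) (tuple0 (tflip _ _ _)).
rewrite (ge0_integral_iidS P n F mF F0).
apply: etrans.
  apply: ge0_integral_iidS => [|t]; last exact: F0.
  by apply: measurableT_comp => //; exact: measurable_tflip.
pose e' := e \o lift ord0.
pose G x := \int[iid_law P n]_t F (tuple_cons (x, t)).
have mG : measurable_fun setT G.
  apply: (measurable_fun_fubini_tonelli_F (F \o @tuple_cons _ R n)).
  - by apply: measurableT_comp => //; exact: measurable_tuple_cons_pair.
  - by move=> z; exact: F0.
have G0 x : 0 <= G x by exact: integral_ge0.
transitivity (\int[P]_x G ((-1) ^+ e ord0 * x)%R); last first.
  case: (e ord0); last by apply: eq_integral => x _; rewrite expr0 mul1r.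
  apply: etrans (Psym G mG G0).
  by apply: eq_integral => x _; rewrite expr1 mulN1r.
apply: eq_integral => x _; rewrite /G.
rewrite -(IH e' (fun t => F (tuple_cons ((-1) ^+ e ord0 * x, t))%R))//; last first.
  by apply: measurableT_comp => //; exact: measurable_tuple_consr.
apply: eq_integral => t _; congr F; apply: eq_from_tnth => i.
rewrite tnth_mktuple; case: (unliftP ord0 i) => [j ->|->]; last by rewrite !tnth0.
by rewrite !tnthS tnth_mktuple.
Qed.

End real_iid.

(** * Rescaling and summing iid Gaussians *)

Section gaussian_iid.
Context {R : realType}.
Local Open Scope ereal_scope.

(** The exponential weight factors over the coordinates, so the one-dimensional tilt is applied to
    each, contributing one factor [k] and one rescaling. The induction is over all [h], because
    peeling off the head [x] replaces [h] by its translate by [x]. *)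
Lemma ge0_integral_iid_normal_tilt (s k l : R) n (h : R -> \bar R) :
  (0 < s)%R -> (0 < k)%R -> (k ^+ 2 * (1 + 2 * l * s ^+ 2) = 1)%R ->
  measurable_fun [set: R] h -> (forall x, 0 <= h x) ->
  \int[iid_law (normal_law 0 s) n]_t
    (h (tsum _ t) * (expR (- (l * tsq _ t)))%:E) =
  (k ^+ n)%:E * \int[iid_law (normal_law 0 s) n]_t h (k * tsum _ t)%R.
Proof.
move=> s0 k0 kl.
elim: n h => [|n IH] h mh h0.
  rewrite expr0 mul1e; apply: eq_integral => t _.
  by rewrite /tsum /tsq !big_ord0 !mulr0 oppr0 expR0 mule1.
have mF m (g : R -> \bar R) : measurable_fun [set: R] g ->
    measurable_fun setT (fun t : m.-tuple R =>
    g (tsum _ t) * (expR (- (l * tsq _ t)))%:E).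
  move=> mg.
  apply: emeasurable_funM; first exact: measurableT_comp.
  apply/measurable_EFinP; apply: measurableT_comp => //.
  by apply: measurableT_comp => //; exact: measurable_funM.
have mkh m : measurable_fun setT (fun t : m.-tuple R => h (k * tsum _ t)%R).
  by apply: measurableT_comp => //; exact: measurable_funM.
rewrite !ge0_integral_iidS//; last 2 first.
- exact: mF.
- by move=> t; rewrite mule_ge0// lee_fin expR_ge0.
pose G x := \int[iid_law (normal_law 0 s) n]_t h (x + k * tsum _ t)%R.
have mG : measurable_fun [set: R] G.
  apply: (measurable_fun_fubini_tonelli_F
    (fun z : R * n.-tuple R => h (z.1 + k * tsum _ z.2)%R)) => //.
  apply: measurableT_comp => //; apply: measurable_funD => //.
  by apply: measurable_funM => //; exact: measurableT_comp.
have G0 x : 0 <= G x by exact: integral_ge0.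
transitivity (\int[normal_law 0 s]_x
    ((k ^+ n)%:E * (G x * (expR (- (l * x ^+ 2)))%:E))).
  apply: eq_integral => x _.
  have mhx : measurable_fun [set: R] (fun y => h (x + y)%R).
    by apply: measurableT_comp => //; exact: measurable_funD.
  have hx0 y : 0 <= h (x + y)%R by [].
  rewrite muleA -[(k ^+ n)%:E * G x](IH _ mhx hx0).
  apply: etrans; last first.
    apply: ge0_integralZr => //.
    - exact: (mF n _ mhx).
    - by move=> t _; rewrite mule_ge0// lee_fin expR_ge0.
  apply: eq_integral => t _; rewrite tsum_cons tsq_cons mulrDr opprD expRD.
  by rewrite EFinM -muleA [X in _ * X]muleC.
rewrite ge0_integralZl//; last 3 first.
- apply: emeasurable_funM => //.
  apply/measurable_EFinP; apply: measurableT_comp => //.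
  by apply: measurableT_comp => //; apply: measurable_funM => //; exact: measurable_funX.
- by move=> x _; rewrite mule_ge0// lee_fin expR_ge0.
- by rewrite lee_fin exprn_ge0// ltW.
rewrite (ge0_integral_normal_law_tilt _ _ _ G s0 k0 kl)// muleA -EFinM exprSr.
congr (_ * _); apply: eq_integral => x _; apply: eq_integral => t _.
by rewrite tsum_cons mulrDr.
Qed.

(** Induction with [ge0_integral_normal_lawD]. Starting from one variable keeps every standard
    deviation positive. *)
Lemma ge0_integral_iid_normal_sum (s : R) n (h : R -> \bar R) :
  (0 < s)%R -> measurable_fun [set: R] h -> (forall x, 0 <= h x) ->
  \int[iid_law (normal_law 0 s) n.+1]_t h (tsum _ t) =
  \int[normal_law 0 (s * Num.sqrt n.+1%:R)%R]_x h x.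
Proof.
move=> s0.
elim: n h => [|n IH] h mh h0.
  apply: etrans.
    apply: ge0_integral_iidS; last by move=> t; exact: h0.
    exact: measurableT_comp.
  rewrite sqrtr1 mulr1; apply: eq_integral => x _.
  rewrite ge0_integral_iid0; last first.
    do 2 apply: measurableT_comp => //.
    exact: measurable_tuple_consr.
  by rewrite tsum_cons /tsum big_ord0 addr0.
apply: etrans.
  apply: ge0_integral_iidS; last by move=> t; exact: h0.
  exact: measurableT_comp.
have sn0 m : (0 < s * Num.sqrt m.+1%:R)%R by rewrite mulr_gt0// sqrtr_gt0.
have rE : ((s * Num.sqrt n.+2%:R) ^+ 2 = (s * Num.sqrt n.+1%:R) ^+ 2 + s ^+ 2)%R.
  by rewrite !exprMn !sqr_sqrtr// -[in LHS]natr1 mulrDr mulr1.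
rewrite -(ge0_integral_normal_lawD _ _ _ _ (sn0 n) s0 (sn0 n.+1) rE mh h0).
apply: eq_integral => x _.
have mhx : measurable_fun [set: R] (fun y => h (x + y)%R).
  by apply: measurableT_comp => //; exact: measurable_funD.
rewrite -(IH _ mhx (fun y => h0 _)).
by apply: eq_integral => t _; rewrite tsum_cons.
Qed.

End gaussian_iid.

(** * The Clarke gradient of a node *)

Section near_diff.
Context {R : realType} {V W : normedModType R}.

(** Differentiability depends only on the germ: the first-order expansion of [f] is also one of [g],
    and the differential is unique. *)
Lemma near_eq_diff (f g : V -> W) (x : V) :
  (\forall z \near x, f z = g z) -> differentiable f x ->
  differentiable g x /\ 'd g x = 'd f x :> (V -> W).
Proof.
move=> fg df.
have gE : g \o shift x = cst (g x) + 'd f x +o_ 0 id.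
  apply/eqaddoP => e e0.
  have /eqaddoP/(_ _ e0) := diff_locally df.
  have : \forall z \near (0 : V), f (z + x) = g (z + x).
    move: fg; rewrite (near_shift 0 x); apply: filterS => z; by rewrite /= subr0.
  apply: filterS2 => z fgz; rewrite /= fctE /= fgz.
  by rewrite (nbhs_singleton fg).
have gd : 'd g x = 'd f x :> (V -> W).
  by apply: diff_unique gE; exact: diff_continuous.
split => //; apply/diff_locallyP; split.
  by rewrite gd; exact: diff_continuous.
by rewrite gd.
Qed.

End near_diff.

Section gradients.
Context {R : realType} {d : nat}.
Implicit Types (w g z : R * 'rV[R]_d) (x v : 'rV[R]_d) (e : 'rV[R]_d * R).

Lemma dotDl x u v : dot (u + v) x = dot u x + dot v x.
Proof. by rewrite /dot -big_split; apply: eq_bigr => j _; rewrite mxE mulrDl. Qed.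

Lemma dotZl x (k : R) u : dot (k *: u) x = k * dot u x.
Proof. by rewrite /dot mulr_sumr; apply: eq_bigr => j _; rewrite mxE mulrA. Qed.

Lemma dotNl x u : dot (- u) x = - dot u x.
Proof. by rewrite -scaleN1r dotZl mulN1r. Qed.

Lemma dotC u v : dot u v = dot v u :> R.
Proof. by apply: eq_bigr => j _; rewrite mulrC. Qed.

Lemma dot0l v : dot 0 v = 0 :> R.
Proof. by apply: big1 => j _; rewrite mxE mul0r. Qed.

Lemma dot_ge0 v : 0 <= dot v v :> R.
Proof. by apply: sumr_ge0 => j _; rewrite -expr2 sqr_ge0. Qed.

Lemma dot_eq0 v : dot v v = 0 :> R -> v = 0.
Proof.
move=> /eqP; rewrite psumr_eq0; last by move=> j _; rewrite -expr2 sqr_ge0.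
move=> /allP h; apply/rowP => j; rewrite mxE; apply/eqP.
by have := h j (mem_index_enum _); rewrite /= mulf_eq0 orbb.
Qed.

Lemma pdot_is_linear g : linear (pdot g : R * 'rV[R]_d -> R^o).
Proof.
move=> k u v; rewrite /pdot/= ![dot g.2 _]dotC dotDl dotZl.
rewrite -[k *: _]/(k * _) -[k *: _]/(k * _); ring.
Qed.

HB.instance Definition _ g :=
  GRing.isLinear.Build _ _ _ _ (pdot g : R * 'rV[R]_d -> R^o) (pdot_is_linear g).

Lemma continuous_pdot g : continuous (pdot g : R * 'rV[R]_d -> R^o).
Proof.
move=> w; apply: cvgD.
  by apply: cvgM; [exact: cvg_cst|exact: cvg_fst].
apply: cvg_big => [|j _]; first exact: add_continuous.
apply: cvgM; first exact: cvg_cst.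
apply: (@cvg_comp _ _ _ snd (fun v : 'rV[R]_d => v ord0 j)); first exact: cvg_snd.
exact: coord_continuous.
Qed.

Lemma differentiable_pdot g w : differentiable (pdot g : R * 'rV[R]_d -> R^o) w.
Proof. by apply: linear_differentiable; exact: continuous_pdot. Qed.

Lemma diff_pdot g w : 'd (pdot g : R * 'rV[R]_d -> R^o) w = pdot g :> (_ -> _).
Proof. by apply: diff_lin; exact: continuous_pdot. Qed.

Lemma pdot_inj g g' : (forall h, pdot g h = pdot g' h) -> g = g'.
Proof.
case: g g' => [a u] [b v] /= h.
have := h (1, 0); rewrite /pdot/= !mulr1 ![dot _ 0]dotC !dot0l !addr0 => ->.
(* Testing against [u - v] makes its squared norm vanish. *)
have /= := h (0, u - v); rewrite /pdot/= !mulr0 !add0r => uv.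
congr (_, _); apply/subr0_eq/dot_eq0.
by rewrite dotDl dotNl uv subrr.
Qed.

Lemma is_gradient_unique f w g g' : is_gradient f w g -> is_gradient f w g' -> g = g'.
Proof. by move=> [_ h] [_ h']; apply: pdot_inj => z; rewrite -h h'. Qed.

Lemma near_eq_is_gradient (f f' : R * 'rV[R]_d -> R^o) w g :
  (\forall z \near w, f z = f' z) -> is_gradient f w g -> is_gradient f' w g.
Proof.
move=> ff' [df fg]; have [df' dd] := near_eq_diff _ _ _ ff' df.
by split; [exact: df'|move=> h; exact: etrans (congr1 (@^~ h) dd) (fg h)].
Qed.

Definition active_grad e w : R * 'rV[R]_d :=
  (e.2 * dot w.2 e.1, (e.2 * w.1) *: e.1).

(** Where the ReLU is active the node is the product of the linear forms [p] and [q], and the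
    product rule applies. *)
Lemma is_gradient_active e w :
  is_gradient (fun z => e.2 * z.1 * dot z.2 e.1) w (active_grad e w).
Proof.
pose p := pdot (e.2, 0) : R * 'rV[R]_d -> R^o.
pose q := pdot (0, e.1) : R * 'rV[R]_d -> R^o.
have pE z : p z = e.2 * z.1 by rewrite /p /pdot/= dot0l addr0.
have qE z : q z = dot z.2 e.1 by rewrite /q /pdot/= mul0r add0r dotC.
have -> : (fun z => e.2 * z.1 * dot z.2 e.1) = p * q.
  by apply/funext => z; rewrite -pE -qE.
have dp := differentiable_pdot (e.2, 0) w.
have dq := differentiable_pdot (0, e.1) w.
split; first exact: differentiableM.
move=> h; rewrite (diffM dp dq) /= !diff_pdot.
rewrite -?/p -?/q !fctE pE !qE /= pE qE /pdot/= dotZl [dot e.1 _]dotC.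
rewrite -[X in X + _]/(_ * _) -[X in _ + X = _]/(_ * _); ring.
Qed.

(** On the kink [dot w.2 e.1 = 0] the value is [0], so that the formula gives the minimum-norm
    Clarke gradient there as well. *)
Definition node_grad e w : R * 'rV[R]_d :=
  if 0 < dot w.2 e.1 then active_grad e w else 0.

Lemma continuous_dot_snd x : continuous (fun w => dot w.2 x : R).
Proof.
move=> w; have := @continuous_pdot (0, x) w.
rewrite (_ : pdot (0, x) = fun w => dot w.2 x)//.
by apply/funext => z; rewrite /pdot/= mul0r add0r dotC.
Qed.

Lemma is_gradient_node e w : dot w.2 e.1 != 0 ->
  is_gradient (node_margin e) w (node_grad e w).
Proof.
have cdot := @continuous_dot_snd e.1 w.
rewrite neq_lt /node_grad => /orP[w0|w0]; last first.
  rewrite w0; apply: near_eq_is_gradient (is_gradient_active e w).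
  have H : \forall z \near w, 0 < dot z.2 e.1 by exact: cvgr_gt cdot _ w0.
  near=> z; have z0 : 0 < dot z.2 e.1 by near: z.
  by rewrite /node_margin /relu max_r// ltW.
rewrite ltNge (ltW w0)/=.
apply: (@near_eq_is_gradient (cst 0)); last first.
  split; first exact: differentiable_cst.
  by move=> h; rewrite diff_cst /pdot/= mul0r dot0l add0r.
have H : \forall z \near w, dot z.2 e.1 < 0 by exact: cvgr_lt cdot _ w0.
near=> z; have z0 : dot z.2 e.1 < 0 by near: z.
by rewrite /node_margin /relu max_l ?mulr0// ltW.
Unshelve. all: by end_near. Qed.

(** Along any sequence tending to [w] the sign of [dot (u k).2 e.1] is eventually that at [w], so
    the gradients come from one continuous branch. Their only possible limit is [node_grad e w], and
    the convex hull of one point is that point. *)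
Lemma clarke_differential_node e w : dot w.2 e.1 != 0 ->
  clarke_differential (node_margin e) w = [set node_grad e w].
Proof.
move=> w0; apply/seteqP; split => [z|_ ->]; last first.
  exists 1%N, (fun=> 1), (fun=> node_grad e w); split => //.
  - by rewrite big_ord1.
  - move=> _; exists (fun=> w), (fun=> node_grad e w); split.
    + exact: cvg_cst.
    + by move=> _; exact: is_gradient_node.
    + exact: cvg_cst.
  - by rewrite big_ord1 scale1r.
move=> [m [l [p [l0 l1 pA ->]]]].
suff pE i : p i = node_grad e w.
  by under eq_bigr do rewrite pE; rewrite -scaler_suml l1 scale1r.
have [u [G [uw uG Gp]]] := pA i.
have cdot := @continuous_dot_snd e.1 w.
have ucdot : dot (u k).2 e.1 @[k --> \oo] --> dot w.2 e.1.
  exact: (cvg_comp _ _ uw cdot).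
have GE k : dot (u k).2 e.1 != 0 -> G k = node_grad e (u k).
  by move=> h; apply: is_gradient_unique (uG k) (is_gradient_node _ _ h).
apply: (cvg_unique _ Gp); first exact: norm_hausdorff.
move: w0; rewrite neq_lt => /orP[w0|w0].
  rewrite /node_grad ltNge (ltW w0)/=; apply: cvg_near_cst.
  have H : \forall k \near \oo, dot (u k).2 e.1 < 0 by exact: cvgr_lt ucdot _ w0.
  near=> k; have k0 : dot (u k).2 e.1 < 0 by near: k.
  by rewrite GE ?lt_eqF// /node_grad ltNge (ltW k0).
rewrite /node_grad w0.
apply: (@cvg_trans _ (active_grad e (u k) @[k --> \oo])).
  apply: near_eq_cvg.
  have H : \forall k \near \oo, 0 < dot (u k).2 e.1 by exact: cvgr_gt ucdot _ w0.
  near=> k; have k0 : 0 < dot (u k).2 e.1 by near: k.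
  by rewrite GE ?gt_eqF// /node_grad k0.
have h1 : e.2 * dot (u k).2 e.1 @[k --> \oo] --> e.2 * dot w.2 e.1.
  by apply: cvgM => //; exact: cvg_cst.
have h2 : (e.2 * (u k).1) *: e.1 @[k --> \oo] --> (e.2 * w.1) *: e.1.
  apply: cvgZr_tmp; apply: cvgM; first exact: cvg_cst.
  exact: (cvg_comp _ _ uw (@cvg_fst _ _ _ _ _)).
exact: (cvg_pair h1 h2).
Unshelve. all: by end_near. Qed.

(** Off the kink the Clarke differential is a singleton. On the kink it contains [0], which is then
    its unique element of least norm. *)
Lemma clarke_min_grad_node e w : e.1 != 0 ->
  clarke_min_grad (node_margin e) w = node_grad e w.
Proof.
move=> e0; have [w0|w0] := eqVneq (dot w.2 e.1) 0; last first.
  rewrite /clarke_min_grad clarke_differential_node//.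
  by apply: xget_unique => [|y [->]//]; split => // h ->.
have c0 : clarke_differential (node_margin e) w 0.
  exists 1%N, (fun=> 1), (fun=> 0); split => //.
  - by rewrite big_ord1.
  (* Moving [w.2] by a vanishing negative multiple of [e.1 != 0] enters the inactive half-space,
     where the gradient is [0]. *)
  - move=> _; exists (fun k => (w.1, w.2 - harmonic k *: e.1)), (fun=> 0); split.
    + have h1 : w.1 @[k --> \oo] --> w.1 by exact: cvg_cst.
      have h2 : w.2 - harmonic k *: e.1 @[k --> \oo] --> w.2.
        rewrite -[X in _ --> X](subr0 w.2) -(scale0r e.1).
        apply: cvgB; first exact: cvg_cst.
        by apply: cvgZr_tmp; exact: cvg_harmonic.
      rewrite [X in _ --> X](surjective_pairing w).
      exact: (cvg_pair h1 h2).
    + move=> k.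
      have k0 : dot (w.2 - harmonic k *: e.1) e.1 < 0.
        rewrite dotDl dotNl dotZl w0 add0r oppr_lt0 mulr_gt0 ?invr_gt0//.
        rewrite lt_neqAle dot_ge0 andbT eq_sym.
        by apply: contra e0 => /eqP/dot_eq0 ->.
      have := is_gradient_node e (w.1, w.2 - harmonic k *: e.1).
      by rewrite /node_grad/= ltNge (ltW k0)/=; apply; rewrite lt_eqF.
    + exact: cvg_cst.
  - by rewrite big_ord1 scaler0.
have pdot0 : pdot (0 : R * 'rV[R]_d) 0 = 0 by rewrite /pdot/= mul0r dot0l addr0.
rewrite /node_grad w0 ltxx; apply: xget_unique.
  split => // h _; rewrite /pnorm2 pdot0 sqrtr0; exact: sqrtr_ge0.
(* Minimality compared with the element [0] forces the norm to vanish. *)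
move=> [a v] [_ /(_ _ c0)]; rewrite /pnorm2 pdot0 sqrtr0 => h.
have : pdot (a, v) (a, v) <= 0.
  by rewrite leNgt; apply/negP => p0; move: h; rewrite leNgt sqrtr_gt0 p0.
rewrite /pdot/= => h'.
have a0 : a * a = 0.
  apply/eqP; rewrite eq_le -expr2 sqr_ge0 andbT expr2.
  by apply: le_trans h'; rewrite lerDl dot_ge0.
have v0 : dot v v = 0 by apply/eqP; rewrite eq_le dot_ge0 andbT; rewrite a0 add0r in h'.
by rewrite (dot_eq0 _ v0); move/eqP: a0; rewrite mulf_eq0 orbb => /eqP ->.
Qed.

End gradients.

(** * Gaussian estimates *)

Lemma measurable_bool_natrE {d} {T : measurableType d} {R : realType} (b : T -> bool) :
  measurable_fun [set: T] b ->
  measurable_fun [set: T] (fun x => (b x)%:R%:E : \bar R).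
Proof.
move=> mb; rewrite (_ : (fun _ => _) = fun x => if b x then 1%E else 0%E).
  exact: measurable_fun_ifT.
by apply/funext => x; case: (b x).
Qed.

Section gaussian_moment.
Context {R : realType}.
Local Notation mu := (@lebesgue_measure R).

Lemma integral_x_gauss (c B : R) : 0 < c -> 0 < B ->
  (\int[mu]_(x in `[0%R, B]) (x * expR (- (c * x ^+ 2)))%:E =
   ((1 - expR (- (c * B ^+ 2))) / (2 * c))%:E)%E.
Proof.
move=> c0 B0.
pose F (x : R) : R := - (2 * c)^-1 * expR (- (c * x ^+ 2)).
have dF (x : R) : is_derive x 1 F (x * expR (- (c * x ^+ 2))).
  rewrite /F; apply: is_derive_eq.
  by rewrite /GRing.scale/=; field; rewrite gt_eqF.
have cF : continuous F.
  by move=> x; apply/differentiable_continuous/derivable1_diffP.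
have cf : continuous (fun x : R => x * expR (- (c * x ^+ 2)) : R).
  move=> x; apply: cvgM; first exact: cvg_id.
  apply: (cvg_comp _ expR); last exact: continuous_expR.
  apply: cvgN; apply: cvgM; first exact: cvg_cst.
  exact: sqr_continuous.
rewrite (@continuous_FTC2 _ _ F)//.
- rewrite -EFinB /F; congr EFin; rewrite expr0n mulr0 oppr0 expR0.
  by field; rewrite gt_eqF.
- by apply: continuous_subspaceT.
- split; first by move=> z _; exact: ex_derive.
  + by apply/cvg_at_right_filter; exact: cF.
  + by apply/cvg_at_left_filter; exact: cF.
- by move=> z _; rewrite derive1E; apply: derive_val.
Qed.

(** The weight and the density combine into one Gaussian exponential of rate [k + 1 / (2 s^2)],
    which reduces the integral to [integral_x_gauss]. *)
Lemma ge0_integral_normal_law_x_gauss (s k B : R) : 0 < s -> 0 <= k -> 0 < B ->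
  (\int[normal_law 0 s]_x
     (if 0 <= x <= B then x * expR (- (k * x ^+ 2)) else 0)%:E =
   (normal_peak s * ((1 - expR (- ((k + (s ^+ 2 *+ 2)^-1) * B ^+ 2))) /
     (2 * (k + (s ^+ 2 *+ 2)^-1))))%:E)%E.
Proof.
move=> s0 k0 B0; have sn0 : s != 0 by rewrite gt_eqF.
have s20 : 0 < (s ^+ 2 *+ 2)^-1 by rewrite invr_gt0 mulrn_wgt0// exprn_gt0.
have mg c : measurable_fun [set: R] (fun x : R => x * expR (- (c * x ^+ 2))).
  apply: measurable_funM => //; apply: measurableT_comp => //.
  by apply: measurableT_comp => //; apply: measurable_funM => //; exact: measurable_funX.
have mf : measurable_fun [set: R]
    (fun x : R => (if 0 <= x <= B then x * expR (- (k * x ^+ 2)) else 0)%:E).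
  apply/measurable_EFinP; apply: measurable_fun_ifT => //.
  by apply: measurable_and; exact: measurable_fun_ler.
apply: etrans.
  apply: (ge0_integral_normal_law 0 s _ mf) => x; case: ifPn => // /andP[x0 _].
  by rewrite lee_fin mulr_ge0// expR_ge0.
have c0 : 0 < k + (s ^+ 2 *+ 2)^-1 by rewrite ltr_wpDl.
rewrite EFinM -(integral_x_gauss _ _ c0 B0) -ge0_integralZl//; last 3 first.
- have mgB : measurable_fun (`[0, B]%classic : set R)
      (fun x : R => (x * expR (- ((k + (s ^+ 2 *+ 2)^-1) * x ^+ 2)))%:E).
    by apply: measurable_funTS; exact/measurable_EFinP.
  exact: mgB.
- by move=> x; rewrite /= in_itv/= => /andP[x0 _]; rewrite lee_fin mulr_ge0// expR_ge0.
- by rewrite lee_fin normal_peak_ge0.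
rewrite [RHS]integral_mkcond; apply: eq_integral => x _.
rewrite patchE mem_setE in_itv/=; case: ifP => _; last by rewrite mul0e.
rewrite -!EFinM normal_pdf0E//; congr EFin.
rewrite mulrDl opprD expRD [(s ^+ 2 *+ 2)^-1 * _]mulrC.
ring.
Qed.

(* The density is at least its value at [u] on the whole of [-u, u]. *)
Lemma normal_law_itv_ge (r u : R) : 0 < r -> 0 <= u ->
  ((2 * u * normal_pdf 0 r u)%:E <=
   \int[normal_law 0 r]_x ((- u < x) && (x <= u))%:R%:E)%E.
Proof.
move=> r0 u0; have rn0 : r != 0 by rewrite gt_eqF.
have mb : measurable_fun [set: R] (fun x : R => ((- u < x) && (x <= u))%:R%:E : \bar R).
  apply: measurable_bool_natrE; apply: measurable_and; first exact: measurable_fun_ltr.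
  exact: measurable_fun_ler.
rewrite [leRHS](_ : _ = (\int[mu]_x
    (((- u < x) && (x <= u))%:R%:E * (normal_pdf 0 r x)%:E))%E); last first.
  by apply: (ge0_integral_normal_law 0 r _ mb) => x; rewrite lee_fin ler0n.
have -> : ((2 * u * normal_pdf 0 r u)%:E =
    \int[mu]_(x in `](- u)%R, u%R]) (normal_pdf 0 r u)%:E)%E.
  rewrite integral_cst//= lebesgue_measure_itv/= lte_fin -EFinB.
  have [uu|uu] := ltP (- u) u; first by rewrite -EFinM; congr EFin; ring.
  have -> : u = 0 by lra.
  by rewrite mulr0 mul0r mule0.
rewrite integral_mkcond; apply: ge0_le_integral => //=.
- by move=> x _; rewrite patchE; case: ifP => _ //; rewrite lee_fin normal_pdf_ge0.
- by apply/(measurable_restrictT _ _).1 => //; exact: measurable_cst.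
- by apply: emeasurable_funM => //; exact: measurable_normal_pdf_EFin.
move=> x _; rewrite patchE mem_setE in_itv/=; case: ifPn => [/andP[ux xu]|_]; last by rewrite mul0e.
rewrite mul1e lee_fin !normal_pdf0E// ler_wpM2l ?normal_peak_ge0// ler_expR lerN2.
rewrite ler_pM2r ?invr_gt0 ?mulrn_wgt0 ?exprn_gt0//.
by rewrite -[leLHS]real_normK ?num_real// lerXn2r ?nnegrE// ler_norml xu ltW.
Qed.

End gaussian_moment.

(** * Numerical bounds and the truncated absolute moment *)

Section numerics.
Context {R : realType}.

(** From [pi < 4], since the right-hand side is the square root of [8]. *)
Lemma sqrt_pi2_le : Num.sqrt (pi *+ 2 : R) <= 2 * Num.sqrt 2.
Proof.
have h : 0 <= 2 * Num.sqrt 2 :> R by rewrite mulr_ge0// sqrtr_ge0.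
have p0 : 0 <= pi *+ 2 :> R by rewrite mulrn_wge0// pi_ge0.
rewrite -(ler_pXn2r (n := 2))// ?nnegrE ?sqrtr_ge0// exprMn (sqr_sqrtr p0) sqr_sqrtr//.
have := @pihalf_lt2 R; lra.
Qed.

Lemma expR_half_le : expR (- 2^-1) <= 5 / 8 :> R.
Proof.
have h : 8 / 5 <= expR 2^-1 :> R.
  (* The bound [1 + x <= expR x] at [1 / 8], raised to the fourth power, gives [6561 / 4096], just
     above [8 / 5]. *)
  rewrite (_ : 2^-1 = 8^-1 * 4%:R); last by field.
  rewrite expRM_natr; apply: (@le_trans _ _ ((9 / 8) ^+ 4)).
    have -> : (9 / 8) ^+ 4 = 6561 / 4096 :> R by field.
    lra.
  rewrite lerXn2r ?nnegrE ?expR_ge0//.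
  apply: le_trans (expR_ge1Dx _); lra.
rewrite expRN -[leRHS]invrK lef_pV2 ?posrE ?expR_gt0//; lra.
Qed.

Lemma expR_le_tenth (c : R) : 9 / 2 <= c -> expR (- c) <= 1 / 10 :> R.
Proof.
move=> c92; have h : 10 <= expR c.
  (* Here [1 + x <= expR x] is used at [3 / 2] and cubed: [(5 / 2)^3 > 10]. *)
  apply: (@le_trans _ _ (expR (3 / 2 * 3%:R))); last by rewrite ler_expR; lra.
  rewrite expRM_natr; apply: (@le_trans _ _ ((5 / 2) ^+ 3)).
    have -> : (5 / 2) ^+ 3 = 125 / 8 :> R by field.
    lra.
  rewrite lerXn2r ?nnegrE ?expR_ge0//.
  apply: le_trans (expR_ge1Dx _); lra.
rewrite expRN -[leRHS]invrK lef_pV2 ?posrE ?expR_gt0//; lra.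
Qed.

(** By symmetry the integral is [2 (1 - exp (- 1 / 2)) / sqrt (2 pi)], at least
    [2 (3 / 8) / (2 sqrt 2)] by the two bounds above. *)
Lemma abs_normal_law_ge :
  ((3 / (8 * Num.sqrt 2))%:E <=
   \int[normal_law (0 : R) 1]_x (if `|x| <= 1 then `|x| else 0)%R%:E)%E.
Proof.
(* The trivial factor [expR (- (0 * x ^+ 2))] matches [ge0_integral_normal_law_x_gauss] at
   [k = 0]. *)
pose f (x : R) : \bar R := (if 0 <= x <= 1 then x * expR (- (0 * x ^+ 2)) else 0)%:E.
have mf : measurable_fun [set: R] f.
  apply/measurable_EFinP; apply: measurable_fun_ifT => //.
    by apply: measurable_and; exact: measurable_fun_ler.
  rewrite (_ : (fun _ => _) = id)//.
  by apply/funext => x; rewrite mul0r oppr0 expR0 mulr1.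
have f0 x : (0 <= f x)%E.
  by rewrite /f lee_fin; case: ifP => // /andP[x0 _]; rewrite mulr_ge0// expR_ge0.
have := ge0_integral_normal_law_x_gauss 1 0 1 ltr01 (lexx _) ltr01; rewrite -/f => fE.
rewrite (_ : (\int[_]_x _)%E = \int[normal_law (0 : R) 1]_x (f x + f (- x)%R))%E; last first.
  apply: eq_integral => x _; rewrite /f -EFinD !mul0r oppr0 expR0 !mulr1; congr EFin.
  have [x0|x0|->] := ltgtP x 0; last by rewrite normr0 oppr0 !if_same addr0.
  - by rewrite ltr0_norm// oppr_ge0 (ltW x0)/= add0r.
  - by rewrite gtr0_norm// oppr_ge0 (leNgt x 0) x0/= addr0.
rewrite ge0_integralD//; last by apply: measurableT_comp.
rewrite ge0_integral_normal_lawN ?oner_eq0// fE -EFinD lee_fin.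
rewrite normal_peakE// add0r !expr1n mulr1 invr1 mul1r.
have h := expR_half_le; have q := sqrt_pi2_le.
have p0 : 0 < Num.sqrt (pi *+ 2) :> R by rewrite sqrtr_gt0 mulrn_wgt0// pi_gt0.
have r0 : 0 < Num.sqrt 2 :> R by rewrite sqrtr_gt0.
rewrite -mulrDr; apply: (@le_trans _ _ ((2 * Num.sqrt 2)^-1 * (3 / 4))).
  by rewrite le_eqVlt; apply/orP; left; apply/eqP; field; rewrite gt_eqF.
apply: ler_pM => //.
- by rewrite lef_pV2 ?posrE ?mulr_gt0.
- by rewrite divff// divr1; lra.
Qed.

End numerics.

(** * The probability of the cone and of its truncation *)

Section cone.
Context {R : realType}.
Local Open Scope ereal_scope.
Variables (m : nat).
(** [m.+2] is the dimension, and [I] below is the law of the [m.+1] coordinates other than the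
    distinguished one. *)
Let D : R := m.+2%:R.
Let s : R := (Num.sqrt D)^-1.
Let N := normal_law (0 : R) s.
Let I := iid_law N m.+1.

(** Open on the left and closed on the right, so that [quadrant_diff] holds pointwise, with no null
    set to discard. *)
Definition in_cone (u x : R) : bool := (0 < u)%R && ((- u < x) && (x <= u))%R.

Lemma in_coneM k u x : (0 < k)%R -> in_cone (k * u) (k * x) = in_cone u x.
Proof. by move=> k0; rewrite /in_cone pmulr_rgt0// -mulrN ltr_pM2l// ler_pM2l. Qed.

Lemma measurable_in_cone d (T : measurableType d) (f g : T -> R) :
  measurable_fun setT f -> measurable_fun setT g ->
  measurable_fun setT (fun z => in_cone (f z) (g z)).
Proof.
move=> mf mg; apply: measurable_and; first exact: measurable_fun_ltr.
apply: measurable_and; last exact: measurable_fun_ler.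
by apply: measurable_fun_ltr => //; exact: measurableT_comp.
Qed.

Let D0 : (0 < D)%R. Proof. by rewrite ltr0n. Qed.
Let s0 : (0 < s)%R. Proof. by rewrite invr_gt0 sqrtr_gt0. Qed.
Let s2 : (s ^+ 2 = D^-1)%R. Proof. by rewrite exprVn sqr_sqrtr// ltW. Qed.

(** Given [u], the sum of the other coordinates is Gaussian with standard deviation [r], so it falls
    in the interval with probability at least [2 u] times its density at [u]. Integrating this bound
    over [0 <= u <= 3 s] is explicit. *)
Lemma cone_ge : ((9 / (40 * (Num.sqrt 2 * Num.sqrt D)))%:E <=
  \int[N]_u \int[I]_t (in_cone u (tsum _ t))%:R%:E).
Proof.
pose r := (s * Num.sqrt m.+1%:R)%R.
have r0 : (0 < r)%R by rewrite mulr_gt0// sqrtr_gt0.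
have rn0 : (r != 0)%R by rewrite gt_eqF.
pose k := ((r ^+ 2 *+ 2)^-1)%R.
have k0 : (0 <= k)%R by rewrite invr_ge0 mulrn_wge0// sqr_ge0.
have B0 : (0 < 3 * s)%R by rewrite mulr_gt0.
pose f (u : R) : R := if (0 <= u <= 3 * s)%R then (u * expR (- (k * u ^+ 2)))%R else 0%R.
have mf : measurable_fun [set: R] f.
  apply: measurable_fun_ifT => //.
    by apply: measurable_and; exact: measurable_fun_ler.
  apply: measurable_funM => //; apply: measurableT_comp => //.
  by apply: measurableT_comp => //; apply: measurable_funM => //; exact: measurable_funX.
have f0 u : (0 <= f u)%R.
  by rewrite /f; case: ifP => // /andP[u0 _]; rewrite mulr_ge0// expR_ge0.
apply: (@le_trans _ _ (\int[N]_u ((2 * normal_peak r)%:E * (f u)%:E))); last first.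
  apply: ge0_le_integral => //.
  - by move=> u _; rewrite mule_ge0// lee_fin// mulr_ge0// normal_peak_ge0.
  - by apply: emeasurable_funM => //; exact/measurable_EFinP.
  - apply: (measurable_fun_fubini_tonelli_F
      (fun z : R * m.+1.-tuple R => (in_cone z.1 (tsum _ z.2))%:R%:E)) => //.
    apply: measurable_bool_natrE; apply: measurable_in_cone => //.
    exact: measurableT_comp.
  move=> u _; have [u0|u0] := ltP 0%R u; last first.
    apply: (@le_trans _ _ 0); last exact: integral_ge0.
    rewrite -EFinM lee_fin mulr_ge0_le0 ?mulr_ge0 ?normal_peak_ge0// /f.
    case: ifP => // /andP[u0' _]; have -> : u = 0%R by apply: le_anti; rewrite u0 u0'.
    by rewrite mul0r.
  rewrite (ge0_integral_iid_normal_sum s m (fun x => (in_cone u x)%:R%:E))//; last first.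
    by apply: measurable_bool_natrE; apply: measurable_in_cone.
  rewrite /in_cone u0/=; apply: le_trans (normal_law_itv_ge _ _ r0 (ltW u0)).
  rewrite -EFinM lee_fin normal_pdf0E// /f; case: ifP => _; last first.
    by rewrite mulr0 !mulr_ge0 ?normal_peak_ge0 ?expR_ge0// ltW.
  rewrite /k [(_^-1 * _)%R]mulrC le_eqVlt; apply/orP; left; apply/eqP; ring.
rewrite ge0_integralZl//; last 3 first.
- exact/measurable_EFinP.
- by move=> u _; rewrite lee_fin.
- by rewrite lee_fin mulr_ge0// normal_peak_ge0.
rewrite (ge0_integral_normal_law_x_gauss _ _ _ s0 k0 B0) -EFinM lee_fin.
rewrite !normal_peakE//.
pose p : R := Num.sqrt D; pose q : R := Num.sqrt m.+1%:R.
pose P : R := Num.sqrt (pi *+ 2); pose t : R := Num.sqrt 2.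
have p0 : (0 < p)%R by rewrite sqrtr_gt0.
have q0 : (0 < q)%R by rewrite sqrtr_gt0.
have t0 : (0 < t)%R by rewrite sqrtr_gt0.
have P0 : (0 < P)%R by rewrite sqrtr_gt0 mulrn_wgt0// pi_gt0.
have p2 : (p ^+ 2 = q ^+ 2 + 1)%R by rewrite !sqr_sqrtr// natr1.
have t2 : (t ^+ 2 = 2)%R by rewrite sqr_sqrtr.
have P2 : (P ^+ 2 <= 8)%R.
  have h : (0 <= pi *+ 2 :> R)%R by rewrite mulrn_wge0// pi_ge0.
  rewrite (sqr_sqrtr h); have := @pihalf_lt2 R; lra.
have q2 : (1 <= q ^+ 2)%R by rewrite sqr_sqrtr// ler1n.
(* The rates [p^2 / (2 q^2)] and [p^2 / 2] are added using [q^2 + 1 = p^2]. *)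
have cE : (k + (s ^+ 2 *+ 2)^-1 = p ^+ 2 * p ^+ 2 / (2 * q ^+ 2))%R.
  by rewrite {2}p2 /k /r -/q /s -/p; field; rewrite !gt_eqF.
rewrite -/p -/t -/P cE.
set e := expR _.
(* The cutoff [3 s] makes the exponent [9/2 * (p^2 / q^2) >= 9/2], so the missing tail costs at most
   a tenth. *)
have e1 : (e <= 1 / 10)%R.
  apply: expR_le_tenth; rewrite /s -/p.
  rewrite [leRHS](_ : (_ = 9 / 2 * (p ^+ 2 / q ^+ 2))%R); last by field; rewrite !gt_eqF.
  by rewrite ler_peMr// ler_pdivlMr ?exprn_gt0// mul1r p2 lerDl.
rewrite [leRHS](_ : _ = (2 * q * (1 - e) / (P ^+ 2 * p ^+ 2))%R); last first.
  by rewrite /r /s -/p -/q; field; rewrite !gt_eqF.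
(* That is, [m.+2 <= 2 * m.+1]. With [1 - e >= 9 / 10] and [P ^+ 2 <= 8] it yields the constant
   [9 / 40]. *)
have qtp : (p <= q * t)%R.
  have qt0 : (0 <= q * t)%R by rewrite mulr_ge0// ltW.
  rewrite -(ler_pXn2r (n := 2))// ?nnegrE ?(ltW p0)// exprMn t2 p2; lra.
rewrite ler_pdivlMr ?mulr_gt0 ?exprn_gt0//.
rewrite mulrAC ler_pdivrMr ?mulr_gt0//.
apply: (@le_trans _ _ (9 * (8 * (p * (q * t))))%R).
  rewrite ler_wpM2l//; apply: ler_pM; rewrite ?sqr_ge0//.
  by rewrite expr2 ler_wpM2l// ltW.
have : (9 / 10 <= 1 - e)%R by lra.
have qtp0 : (0 <= q * t * p)%R by rewrite ltW// !mulr_gt0.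
move=> /(ler_wpM2r qtp0); lra.
Qed.

(* The tilt rescales all coordinates, and the cone is invariant under scaling. *)
Lemma cone_tilt (l k : R) : (0 < k)%R -> (k ^+ 2 * (1 + 2 * l * s ^+ 2) = 1)%R ->
  \int[N]_u \int[I]_t ((in_cone u (tsum _ t))%:R *
     expR (- (l * (u ^+ 2 + tsq _ t))))%:E =
  (k ^+ m.+2)%:E * \int[N]_u \int[I]_t (in_cone u (tsum _ t))%:R%:E.
Proof.
move=> k0 kl.
have mc (a : R) : measurable_fun setT
    (fun z : R * m.+1.-tuple R => (in_cone z.1 (a * tsum _ z.2)%R)%:R%:E : \bar R).
  apply: measurable_bool_natrE; apply: measurable_in_cone => //.
  by apply: measurable_funM => //; exact: measurableT_comp.
pose G u := \int[I]_t (in_cone u (k * tsum _ t)%R)%:R%:E.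
have mG : measurable_fun [set: R] G by exact: (measurable_fun_fubini_tonelli_F _ (mc k)).
have G0 u : 0 <= G u by exact: integral_ge0.
have me : measurable_fun [set: R] (fun x : R => (expR (- (l * x ^+ 2)))%:E).
  apply/measurable_EFinP; apply: measurableT_comp => //.
  by apply: measurableT_comp => //; apply: measurable_funM => //; exact: measurable_funX.
(* The tail is tilted first, with [u] fixed; tilting [u] itself supplies the last factor [k]. *)
transitivity (\int[N]_u ((k ^+ m.+1)%:E * (G u * (expR (- (l * u ^+ 2)))%:E))).
  apply: eq_integral => u _.
  pose h (x : R) : \bar R := (in_cone u x)%:R%:E.
  have mh : measurable_fun [set: R] h.
    by apply: measurable_bool_natrE; apply: measurable_in_cone.
  have h0 x : 0 <= h x by rewrite lee_fin ler0n.
  have := ge0_integral_iid_normal_tilt s k l m.+1 h s0 k0 kl mh h0.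
  rewrite -/I muleA => <-.
  apply: etrans; last first.
    apply: ge0_integralZr => //.
    - apply: emeasurable_funM; first exact: measurableT_comp.
      apply/measurable_EFinP; apply: measurableT_comp => //.
      by apply: measurableT_comp => //; exact: measurable_funM.
    - by move=> t _; rewrite mule_ge0// lee_fin expR_ge0.
  apply: eq_integral => t _; rewrite -!EFinM; congr EFin.
  by rewrite mulrDr opprD expRD; ring.
rewrite ge0_integralZl//; last 3 first.
- exact: emeasurable_funM.
- by move=> u _; rewrite mule_ge0// lee_fin expR_ge0.
- by rewrite lee_fin exprn_ge0// ltW.
rewrite (ge0_integral_normal_law_tilt _ _ _ G s0 k0 kl)// muleA -EFinM -exprSr.
congr (_ * _); apply: eq_integral => u _; apply: eq_integral => t _.
by rewrite in_coneM.
Qed.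

(** Ensures finiteness, so that [cone_trunc_ge] can be concluded by real arithmetic. *)
Lemma cone_prod_le1 : \int[N]_u \int[I]_t (in_cone u (tsum _ t))%:R%:E <= 1.
Proof.
rewrite -(fubini_tonelli1
  (fun z : R * m.+1.-tuple R => (in_cone z.1 (tsum _ z.2))%:R%:E))//; last first.
  apply: measurable_bool_natrE; apply: measurable_in_cone => //.
  exact: measurableT_comp.
apply: (@le_trans _ _ (\int[(N \x I)%E]_z (cst 1 z))).
  apply: ge0_le_integral => //.
    apply: measurable_bool_natrE; apply: measurable_in_cone => //.
    exact: measurableT_comp.
  by move=> z _; rewrite lee_fin; case: in_cone.
have pT : (N \x I)%E [set: R * m.+1.-tuple R] = 1.
  exact: probability_setT.
by rewrite integral_cst// mul1e [X in X <= _]pT.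
Qed.

(** The comparison of weighted integrals, divided by [1 - tau], leaves the ratio
    [tau (1 + tau) / (1 + tau + tau^2)], which is at least [3 / 5] because [tau >= 9 / 10]. *)
Lemma cone_trunc_ge :
  (3 / 5)%:E * \int[N]_u \int[I]_t (in_cone u (tsum _ t))%:R%:E <=
  \int[N]_u \int[I]_t
    (in_cone u (tsum _ t) && (u ^+ 2 + tsq _ t < 3)%R)%:R%:E.
Proof.
pose b (z : R * m.+1.-tuple R) := in_cone z.1 (tsum _ z.2).
pose q (z : R * m.+1.-tuple R) : R := (z.1 ^+ 2 + tsq _ z.2)%R.
have mb : measurable_fun setT b.
  by apply: measurable_in_cone => //; exact: measurableT_comp.
have mq : measurable_fun setT q.
  by apply: measurable_funD; [exact: measurable_funX|exact: measurableT_comp].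
have mbE : measurable_fun setT (fun z => (b z)%:R%:E : \bar R).
  exact: measurable_bool_natrE.
have mbq : measurable_fun setT (fun z => (b z && (q z < 3)%R)%:R%:E : \bar R).
  by apply: measurable_bool_natrE; apply: measurable_and => //; exact: measurable_fun_ltr.
pose l : R := (10^-1)%R.
pose tau := expR (- l)%R.
have tau0 : (0 < tau)%R by exact: expR_gt0.
have tau9 : (9 / 10 <= tau)%R by apply: le_trans (expR_ge1Dx _); rewrite /l; lra.
have tau1 : (tau < 1)%R by rewrite -expR0 ltr_expR /l; lra.
pose k := ((Num.sqrt (1 + 2 * l * s ^+ 2))^-1)%R.
have w0 : (0 < 1 + 2 * l * s ^+ 2)%R by rewrite ltr_wpDr// !mulr_ge0// ?sqr_ge0// invr_ge0.
have k0 : (0 < k)%R by rewrite invr_gt0 sqrtr_gt0.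
have kl : (k ^+ 2 * (1 + 2 * l * s ^+ 2) = 1)%R.
  by rewrite exprVn sqr_sqrtr ?(ltW w0)// mulVf// gt_eqF.
(* As [s ^+ 2 = 1 / D], the right-hand side is [(1 + 2 l / D)^(- D / 2)], and [1 + x <= expR x]
   bounds it below by [exp (- l)] in every dimension. *)
have ktau : (tau <= k ^+ m.+2)%R.
  rewrite /tau (_ : (- l = - (l / D) * m.+2%:R)%R); last by rewrite mulNr divfK// gt_eqF.
  rewrite expRM_natr lerXn2r ?nnegrE ?expR_ge0 ?(ltW k0)//.
  rewrite expRN /k lef_pV2 ?posrE ?expR_gt0 ?sqrtr_gt0//.
  rewrite -(ler_pXn2r (n := 2)) ?nnegrE ?expR_ge0 ?sqrtr_ge0// sqr_sqrtr ?(ltW w0)//.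
  rewrite -expRM_natr; apply: le_trans (expR_ge1Dx _).
  by rewrite s2 lerD2l le_eqVlt; apply/orP; left; apply/eqP; ring.
pose E (z : R * m.+1.-tuple R) : \bar R := ((b z)%:R * expR (- (l * q z)))%:E.
have mE : measurable_fun setT E.
  rewrite /E (_ : (fun _ => _) = fun z => (b z)%:R%:E * (expR (- (l * q z)))%:E)//.
  apply: emeasurable_funM => //; apply/measurable_EFinP; apply: measurableT_comp => //.
  by apply: measurableT_comp => //; exact: measurable_funM.
have tilt := cone_tilt l k k0 kl.
rewrite -(fubini_tonelli1 E mE) in tilt; last first.
  by move=> z; rewrite lee_fin mulr_ge0// expR_ge0.
rewrite -(fubini_tonelli1 _ mbE) in tilt *; last by move=> z; rewrite lee_fin.
have le1 := cone_prod_le1.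
rewrite -(fubini_tonelli1 _ mbE) in le1; last by move=> z; rewrite lee_fin.
rewrite -(fubini_tonelli1 _ mbq); last by move=> z; rewrite lee_fin.
set K := \int[_]_z (b z)%:R%:E in tilt le1 *.
set P0 := \int[_]_z _.
have KE : K = (fine K)%:E.
  by rewrite fineK// ge0_fin_numE ?integral_ge0// (le_lt_trans le1) ?ltry.
have K0 : (0 <= fine K)%R by rewrite fine_ge0 ?integral_ge0.
have P1 : P0 <= 1.
  apply: le_trans le1; apply: ge0_le_integral => // z _.
  by rewrite lee_fin; case: (b z) => //=; case: (_ < _)%R.
have PE : P0 = (fine P0)%:E.
  by rewrite fineK// ge0_fin_numE ?integral_ge0// (le_lt_trans P1) ?ltry.
have key : (k ^+ m.+2)%:E * K <= (tau ^+ 3)%:E * K + (1 - tau ^+ 3)%:E * P0.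
  have tau3 : (0 <= 1 - tau ^+ 3)%R by rewrite subr_ge0 exprn_ile1// ltW.
  rewrite -tilt -ge0_integralZl//; last by rewrite lee_fin exprn_ge0// ltW.
  rewrite -ge0_integralZl// -ge0_integralD//; last 4 first.
  - by move=> z _; rewrite -EFinM lee_fin mulr_ge0// exprn_ge0// ltW.
  - exact: emeasurable_funM.
  - by move=> z _; rewrite -EFinM lee_fin mulr_ge0.
  - exact: emeasurable_funM.
  apply: ge0_le_integral => //.
  - by move=> z _; rewrite lee_fin mulr_ge0// expR_ge0.
  - by apply: emeasurable_funD; exact: emeasurable_funM.
  move=> z _; rewrite /E -!EFinM -EFinD lee_fin.
  case: (b z); rewrite ?mul0r ?mulr0 ?addr0//= !mul1r mulr1.
  have q0 : (0 <= q z)%R.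
    by rewrite addr_ge0 ?sqr_ge0// sumr_ge0// => j _; exact: sqr_ge0.
  (* Inside the cone: for [q z < 3] the right-hand side is [1]; otherwise it is
     [tau ^+ 3 = exp (- 3 / 10)], which dominates the weight. *)
  have [q3|q3] := ltP (q z) 3%R; rewrite /= ?mulr1 ?mulr0 ?addr0.
    rewrite addrC subrK -expR0 ler_expR oppr_le0 mulr_ge0//.
    by rewrite invr_ge0.
  rewrite /tau -expRM_natr ler_expR mulNr lerN2 ler_wpM2l// invr_ge0//.
move: key; rewrite KE PE -!EFinM -EFinD !lee_fin => key.
have : (tau * fine K <= tau ^+ 3 * fine K + (1 - tau ^+ 3) * fine P0)%R.
  by apply: le_trans key; rewrite ler_wpM2r.
set x := fine K; set y := fine P0 => h.
have h1 : ((tau * (1 + tau)) * x <= (1 + tau + tau ^+ 2) * y)%R.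
  rewrite -(ler_pM2l (_ : (0 < 1 - tau)%R)) ?subr_gt0//.
  have -> : ((1 - tau) * (tau * (1 + tau) * x) = tau * x - tau ^+ 3 * x)%R by ring.
  have -> : ((1 - tau) * ((1 + tau + tau ^+ 2) * y) = (1 - tau ^+ 3) * y)%R by ring.
  lra.
rewrite -(ler_pM2l (_ : (0 < 1 + tau + tau ^+ 2)%R)); last by rewrite !addr_gt0// exprn_gt0.
apply: le_trans h1; rewrite mulrA ler_wpM2r//.
nra.
Qed.

(** The components of [z] are the distinguished coordinate, the sum of all coordinates and the
    squared norm. *)
Definition quadrant (z : R * (R * R)) : bool :=
  ((0 < z.1) && (0 < z.2.1) && (z.2.2 < 3))%R.

Lemma measurable_quadrant : measurable_fun setT quadrant.
Proof.
apply: measurable_and; last by apply: measurable_fun_ltr => //; exact: measurableT_comp.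
apply: measurable_and; first exact: measurable_fun_ltr.
by apply: measurable_fun_ltr => //; exact: measurableT_comp.
Qed.

(* Reflecting the first coordinate turns the second quadrant into
   [0 < u, u < S] for [S] the sum of the other coordinates, and the cone is
   what remains of [0 < u, - u < S]. *)
Lemma quadrant_diff :
  \int[N]_u \int[I]_t (quadrant (u, (u + tsum _ t, u ^+ 2 + tsq _ t)%R))%:R%:E =
  \int[N]_u \int[I]_t (quadrant (- u, (u + tsum _ t, u ^+ 2 + tsq _ t))%R)%:R%:E +
  \int[N]_u \int[I]_t
    (in_cone u (tsum _ t) && (u ^+ 2 + tsq _ t < 3)%R)%:R%:E.
Proof.
(* The signs [a] and [c] express both quadrant integrands, before and after the reflection, in one
   family. *)
pose F (a c : R) (z : R * m.+1.-tuple R) : \bar R :=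
  (quadrant (a * z.1, (c * z.1 + tsum _ z.2, z.1 ^+ 2 + tsq _ z.2))%R)%:R%:E.
have mF a c : measurable_fun setT (F a c).
  apply: measurable_bool_natrE; apply: measurableT_comp; first exact: measurable_quadrant.
  apply: measurable_fun_pair; first exact: measurable_funM.
  apply: measurable_fun_pair; apply: measurable_funD => //.
  - exact: measurable_funM.
  - exact: measurableT_comp.
  - exact: measurable_funX.
  - exact: measurableT_comp.
have F0 a c z : 0 <= F a c z by rewrite lee_fin.
pose C (z : R * m.+1.-tuple R) : \bar R :=
  (in_cone z.1 (tsum _ z.2) && (z.1 ^+ 2 + tsq _ z.2 < 3)%R)%:R%:E.
have mC : measurable_fun setT C.
  apply: measurable_bool_natrE; apply: measurable_and.
    by apply: measurable_in_cone => //; exact: measurableT_comp.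
  apply: measurable_fun_ltr => //.
  by apply: measurable_funD; [exact: measurable_funX|exact: measurableT_comp].
have C0 z : 0 <= C z by rewrite lee_fin.
have -> : \int[N]_u \int[I]_t (quadrant (- u, (u + tsum _ t, u ^+ 2 + tsq _ t))%R)%:R%:E =
    \int[N]_u \int[I]_t F 1%R (-1)%R (u, t).
  pose g u := \int[I]_t F 1%R (-1)%R (u, t).
  have mg : measurable_fun setT g by exact: (measurable_fun_fubini_tonelli_F _ (mF 1%R (-1)%R)).
  have g0 u : 0 <= g u by exact: integral_ge0.
  have sn0 : s != 0%R by rewrite gt_eqF.
  rewrite -[RHS](ge0_integral_normal_lawN s g sn0 mg g0).
  apply: eq_integral => u _; apply: eq_integral => t _.
  by rewrite /F/= mul1r mulN1r opprK sqrrN.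
have -> : \int[N]_u \int[I]_t (quadrant (u, (u + tsum _ t, u ^+ 2 + tsq _ t)%R))%:R%:E =
    \int[N]_u \int[I]_t F 1%R 1%R (u, t).
  by apply: eq_integral => u _; apply: eq_integral => t _; rewrite /F/= !mul1r.
rewrite -[X in _ = _ + X](fubini_tonelli1 C mC C0).
rewrite -!(fubini_tonelli1 _ (mF _ _) (F0 _ _)).
rewrite -ge0_integralD//; apply: eq_integral => -[u t] _.
rewrite /F /C /quadrant/= /in_cone !mul1r mulN1r -EFinD; congr EFin.
case: ltP => //= u0; last by rewrite addr0.
case: (_ < 3)%R; rewrite ?andbT ?andbF ?addr0//=.
rewrite [(0 < u + _)%R](_ : _ = (- u < tsum _ t)%R); last by rewrite -[RHS]subr_gt0 opprK addrC.
rewrite [(0 < - u + _)%R](_ : _ = (u < tsum _ t)%R); last by rewrite -[RHS]subr_gt0 addrC.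
have [ut|ut] := ltP u (tsum _ t); rewrite ?andbF ?andbT ?addr0 ?add0r//.
by rewrite (lt_trans _ ut)// ltrNl (lt_trans _ u0)// oppr_lt0.
Qed.

End cone.

(** * The NTK direction *)

Section measurable_row_vectors.
Context {R : realType} {n : nat}.

Lemma measurable_rV_coord (j : 'I_n) :
  measurable_fun [set: 'rV[R]_n] (fun v : 'rV[R]_n => v ord0 j).
Proof.
move=> _ Y mY; rewrite setTI; apply: sub_sigma_algebra => /=.
rewrite -bigcup_seq/=; exists j => /=; first by rewrite mem_index_enum.
by exists Y => //; rewrite setTI.
Qed.

(** Factoring through tuples reduces this to the measurability of [row_of_tuple]. *)
Lemma measurable_fun_rV d (T : measurableType d) (f : T -> 'rV[R]_n) :
  (forall j, measurable_fun setT (fun x => f x ord0 j)) -> measurable_fun setT f.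
Proof.
move=> mf; pose g x : n.-tuple R := [tuple f x ord0 j | j < n].
have -> : f = @row_of_tuple _ _ n \o g.
  by apply/funext => x; apply/rowP => j; rewrite mxE tnth_mktuple.
apply: measurableT_comp; first exact: measurable_funPT.
apply/measurable_fun_tnthP => j.
rewrite (_ : _ \o _ = fun x => f x ord0 j)//.
by apply/funext => x /=; rewrite tnth_mktuple.
Qed.

Lemma measurable_dot d (T : measurableType d) (f g : T -> 'rV[R]_n) :
  measurable_fun setT f -> measurable_fun setT g ->
  measurable_fun setT (fun x => dot (f x) (g x)).
Proof.
move=> mf mg; apply: measurable_sum => j; apply: measurable_funM.
  exact: (measurableT_comp (measurable_rV_coord j) mf).
exact: (measurableT_comp (measurable_rV_coord j) mg).
Qed.

End measurable_row_vectors.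

Lemma sgrE_bool {R : realDomainType} (x : R) : Num.sg x = (0 < x)%R%:R - (x < 0)%R%:R.
Proof.
have [x0|x0|->] := ltgtP x 0; last by rewrite sgr0 subr0.
- by rewrite ltr0_sg// sub0r.
- by rewrite gtr0_sg// subr0.
Qed.

Lemma measurable_sgr {R : realType} : measurable_fun [set: R] (@Num.sg R).
Proof.
rewrite (_ : Num.sg = fun x : R => (if 0 < x then 1 else 0) - (if x < 0 then 1 else 0)).
  by apply: measurable_funB; apply: measurable_fun_ifT => //; exact: measurable_fun_ltr.
by apply/funext => x; rewrite sgrE_bool; case: (0 < x); case: (x < 0).
Qed.

Section parity_direction.
Context {R : realType} {d : nat}.
Variables a b : 'I_d.

Definition parity_coef (w : R * 'rV[R]_d) : R :=
  if (`|w.1| <= 1) && (dot w.2 w.2 < 3) then Num.sg w.1 * Num.sg (w.2 ord0 b) else 0.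

Definition parity_theta (w : R * 'rV[R]_d) : R * 'rV[R]_d :=
  (0, parity_coef w *: delta_mx ord0 a).

Lemma dot_delta (v : 'rV[R]_d) : dot (delta_mx ord0 a) v = v ord0 a.
Proof.
rewrite /dot (bigD1 a)//= mxE !eqxx mul1r big1 ?addr0// => j ja.
by rewrite mxE (negbTE ja) andbF mul0r.
Qed.

Lemma measurable_parity_coef : measurable_fun setT parity_coef.
Proof.
apply: measurable_fun_ifT => //.
  apply: measurable_and.
    by apply: measurable_fun_ler => //; exact: measurableT_comp.
  by apply: measurable_fun_ltr => //; exact: measurable_dot.
apply: measurable_funM; first exact: (measurableT_comp measurable_sgr).
apply: (measurableT_comp measurable_sgr).
exact: (measurableT_comp (measurable_rV_coord b)).
Qed.

Lemma measurable_parity_theta : measurable_fun setT parity_theta.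
Proof.
apply: measurable_fun_pair => //; apply: measurable_fun_rV => j.
under eq_fun do rewrite mxE.
by apply: measurable_funM => //; exact: measurable_parity_coef.
Qed.

Lemma pdot_parity_theta w z : pdot (parity_theta w) z = parity_coef w * z.2 ord0 a.
Proof. by rewrite /pdot/= mul0r add0r dotZl dot_delta. Qed.

Lemma normr_sg_le1 (x : R) : `|Num.sg x| <= 1.
Proof. by rewrite normr_sg; case: (x != 0). Qed.

Lemma pnorm2_parity_theta w : pnorm2 (parity_theta w) <= 1.
Proof.
rewrite /pnorm2 pdot_parity_theta/= !mxE !eqxx mulr1 -expr2 sqrtr_sqr /parity_coef.
case: ifP => _; last by rewrite normr0.
by rewrite normrM mulr_ile1// normr_sg_le1.
Qed.

(** The thresholds [1] and [3] of [parity_coef] confine its support to squared norms below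
    [1 + 3 = 2 ^+ 2]. *)
Lemma parity_theta_eq0 w : 2 <= pnorm2 w -> parity_theta w = 0.
Proof.
move=> w2; rewrite /parity_theta /parity_coef; case: ifPn => [/andP[w1 w3]|_]; last first.
  by rewrite scale0r.
exfalso; move: w2; apply/negP; rewrite -ltNge /pnorm2.
have p0 : 0 <= pdot w w by rewrite /pdot addr_ge0 ?dot_ge0// -expr2 sqr_ge0.
rewrite -(ltr_pXn2r (n := 2))// ?nnegrE ?sqrtr_ge0// sqr_sqrtr// /pdot.
have : w.1 * w.1 <= 1 by rewrite -expr2 -real_normK ?num_real// exprn_ile1.
lra.
Qed.

End parity_direction.

(** * Reduction of the NTK expectation to the truncated cone *)

Section parity_margin.
Context {R : realType}.
Variables (m : nat).
Let d := m.+2.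
Let s : R := (Num.sqrt d%:R)^-1.
Let N := normal_law (0 : R) s.
Let I := iid_law N m.+1.
Let V : probability 'rV[R]_d R := distribution (iid_law N d) (@row_of_tuple _ _ d).

Let s0 : 0 < s. Proof. by rewrite invr_gt0 sqrtr_gt0 ltr0n. Qed.
Let s2 : d%:R * s ^+ 2 = 1.
Proof. by rewrite exprVn sqr_sqrtr ?ler0n// divff// pnatr_eq0. Qed.

Definition flip_sum (e : 'I_d -> bool) (v : 'rV[R]_d) : R :=
  \sum_j (-1) ^+ e j * v ord0 j.

Definition flip_stat (e : 'I_d -> bool) (b : 'I_d) (v : 'rV[R]_d) : R * (R * R) :=
  ((-1) ^+ e b * v ord0 b, (flip_sum e v, dot v v)).

Lemma measurable_flip_stat e b : measurable_fun setT (flip_stat e b).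
Proof.
apply: measurable_fun_pair.
  by apply: measurable_funM => //; exact: measurable_rV_coord.
apply: measurable_fun_pair; last exact: measurable_dot.
apply: measurable_sum => j.
by apply: measurable_funM => //; exact: measurable_rV_coord.
Qed.

(** Sign flips preserve both the Gaussian law and the squared norm, so the joint law of the
    statistics is the same for every sign pattern [e]; the coordinate [b] is then integrated
    first. *)
Lemma ge0_integral_flip_stat e b (f : R * (R * R) -> \bar R) :
  measurable_fun setT f -> (forall z, (0 <= f z)%E) ->
  (\int[V]_v f (flip_stat e b v) =
   \int[N]_u \int[I]_t f (u, (u + tsum _ t, u ^+ 2 + tsq _ t))%R)%E.
Proof.
move=> mf f0.
have mff : measurable_fun setT (fun v => f (flip_stat e b v)).
  by apply: measurableT_comp => //; exact: measurable_flip_stat.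
rewrite ge0_integral_distribution//.
rewrite -(ge0_integral_iid_extract _ _ b)//.
pose F (t : d.-tuple R) := f (tnth t b, (tsum _ t, tsq _ t)).
have mF : measurable_fun setT F.
  apply: measurableT_comp => //; apply: measurable_fun_pair.
    exact: measurable_tnth.
  exact: measurable_fun_pair.
have F0 t : (0 <= F t)%E by exact: f0.
rewrite -(ge0_integral_iid_flip N _ e F _ mF F0); last first.
  by move=> g mg g0; apply: ge0_integral_normal_lawN => //; rewrite gt_eqF.
apply: eq_integral => t _; rewrite /F /flip_stat /= tnth_mktuple mxE.
congr (f (_, (_, _))).
- by apply: eq_bigr => j _; rewrite tnth_mktuple mxE.
- by apply: eq_bigr => j _; rewrite tnth_mktuple mxE exprMn -signr_odd sqrr_sign mul1r expr2.
Qed.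

Let xsign (x : 'rV[R]_d) (j : 'I_d) : bool := x ord0 j < 0.

Lemma hypercube_sign (x : 'rV[R]_d) j : hypercube x -> x ord0 j = (-1) ^+ xsign x j * s.
Proof.
move=> /(_ j)[] xj; rewrite /xsign xj -/s.
  by rewrite ltNge (ltW s0)/= expr0 mul1r.
by rewrite oppr_lt0 s0/= expr1 mulN1r.
Qed.

Lemma dot_hypercube (x v : 'rV[R]_d) : hypercube x -> dot v x = s * flip_sum (xsign x) v.
Proof.
move=> hx; rewrite /dot /flip_sum mulr_sumr; apply: eq_bigr => j _.
by rewrite (hypercube_sign x j hx); ring.
Qed.

Definition clipped_abs (x : R) : R := if `|x| <= 1 then `|x| else 0.

(** On an active node the integrand is the coefficient times [e.2 * w.1 * x_a]. The sign of [x_b]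
    turns [sg v_b] into the sign of the flipped coordinate, and this sign is a difference of two
    quadrant indicators. *)
Lemma ntk_integrand (a b : 'I_d) (e : 'rV[R]_d * R) (w : R * 'rV[R]_d) :
  hypercube e.1 -> e.2 = d%:R * e.1 ord0 a * e.1 ord0 b ->
  let z := flip_stat (xsign e.1) b w.2 in
  pdot (parity_theta a b w) (clarke_min_grad (node_margin e) w) =
  s * clipped_abs w.1 * ((quadrant z)%:R - (quadrant (- z.1, z.2))%:R).
Proof.
move=> hx ey z.
have xsq j : e.1 ord0 j * e.1 ord0 j = s ^+ 2.
  by rewrite (hypercube_sign _ j hx) -expr2 exprMn -signr_odd sqrr_sign mul1r.
have e0 : e.1 != 0.
  apply/eqP => e10; have := xsq a; rewrite e10 mxE mul0r => /esym/eqP.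
  by rewrite sqrf_eq0 gt_eqF.
(* The parity structure enters here: since [d x_a^2 = 1], multiplying the label by [x_a] leaves
   [x_b]. *)
have yx : e.2 * e.1 ord0 a = e.1 ord0 b.
  transitivity (d%:R * (e.1 ord0 a * e.1 ord0 a) * e.1 ord0 b).
    by rewrite ey; ring.
  by rewrite xsq s2 mul1r.
rewrite pdot_parity_theta clarke_min_grad_node// /node_grad dot_hypercube//.
rewrite pmulr_rgt0// /quadrant/= -/(flip_sum _ _).
case: ifPn => [S0|]; last first.
  by move=> _; rewrite mxE mulr0 !andbF/= subrr mulr0.
rewrite /active_grad/= mxE mulrAC yx !andbT /parity_coef /clipped_abs.
have [q3|q3] := ltP (dot w.2 w.2) 3; last by rewrite !andbF/= mul0r subrr mulr0.
rewrite !andbT oppr_gt0 -sgrE_bool sgrM.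
case: ifP => _; last by rewrite mul0r mulr0 mul0r.
rewrite normrEsg (hypercube_sign _ b hx).
have -> : Num.sg ((-1) ^+ xsign e.1 b) = (-1) ^+ xsign e.1 b :> R.
  by case: xsign; rewrite ?expr1 ?expr0 ?sgrN1 ?sgr1.
ring.
Qed.

Let measurable_clipped_abs : measurable_fun [set: R] clipped_abs.
Proof.
apply: measurable_fun_ifT => //.
by apply: measurable_fun_ler.
Qed.

Let clipped_abs_ge0 x : 0 <= clipped_abs x.
Proof. by rewrite /clipped_abs; case: ifP. Qed.

Let clipped_abs_le1 x : clipped_abs x <= 1.
Proof. by rewrite /clipped_abs; case: ifP. Qed.

Let integral_bool_le1 (q : pred (R * (R * R))) : measurable_fun setT q ->
  (0 <= \int[N]_u \int[I]_t (q (u, (u + tsum _ t, u ^+ 2 + tsq _ t))%R)%:R%:E <= 1)%E.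
Proof.
move=> mq; have mQ : measurable_fun setT (fun z => (q z)%:R%:E : \bar R).
  exact: measurable_bool_natrE.
rewrite -(ge0_integral_flip_stat (fun=> false) ord0 (fun z => (q z)%:R%:E))//.
have mv : measurable_fun setT (fun v => (q (flip_stat (fun=> false) ord0 v))%:R%:E : \bar R).
  by apply: (measurableT_comp mQ); exact: measurable_flip_stat.
rewrite integral_ge0//=; apply: (@le_trans _ _ (\int[V]_v cst 1 v)%E).
  by apply: ge0_le_integral => // v _; rewrite lee_fin; case: (q _).
have pV : (V [set: 'rV[R]_d] = 1)%E by exact: probability_setT.
by rewrite integral_cst// mul1e [X in (X <= _)%E]pV.
Qed.

(** The positive and negative parts of the integrand are the two quadrant terms. Each factors by
    Tonelli into a moment of the outer weight and a probability, and [quadrant_diff] evaluates the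
    difference. *)
Lemma ntk_expectation (a b : 'I_d) (e : 'rV[R]_d * R) :
  hypercube e.1 -> e.2 = d%:R * e.1 ord0 a * e.1 ord0 b ->
  ('E_init_law[fun w => pdot (parity_theta a b w) (clarke_min_grad (node_margin e) w)] =
   (s%:E * \int[normal_law (0 : R) 1]_x (clipped_abs x)%:E) *
   \int[N]_u \int[I]_t (in_cone u (tsum _ t) && (u ^+ 2 + tsq _ t < 3)%R)%:R%:E)%E.
Proof.
move=> hx ey; rewrite unlock.
pose S (w : R * 'rV[R]_d) := flip_stat (xsign e.1) b w.2.
pose neg (z : R * (R * R)) := (- z.1, z.2).
have mneg : measurable_fun setT neg.
  by apply: measurable_fun_pair => //; exact: measurableT_comp.
have mq := @measurable_quadrant R.
have mqn : measurable_fun setT (fun z => quadrant (neg z) : bool).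
  exact: measurableT_comp.
pose H (q : R * (R * R) -> bool) (w : R * 'rV[R]_d) : \bar R :=
  (s * clipped_abs w.1 * (q (S w))%:R)%:E.
have H0 q w : (0 <= H q w)%E by rewrite lee_fin !mulr_ge0// ltW.
have mH q : measurable_fun setT q -> measurable_fun setT (H q).
  move=> mq'; rewrite (_ : H q = fun w => (s * clipped_abs w.1)%:E * (q (S w))%:R%:E)%E.
    apply: emeasurable_funM.
      apply/measurable_EFinP; apply: measurable_funM => //.
      exact: (measurableT_comp measurable_clipped_abs).
    apply: measurable_bool_natrE; apply: (measurableT_comp mq').
    exact: (measurableT_comp (measurable_flip_stat _ _)).
  by apply/funext => w; rewrite -EFinM.
have HE q : measurable_fun setT q -> (\int[init_law]_w H q w =
    (s%:E * \int[normal_law (0 : R) 1]_x (clipped_abs x)%:E) *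
    \int[N]_u \int[I]_t (q (u, (u + tsum _ t, u ^+ 2 + tsq _ t))%R)%:R%:E)%E.
  move=> mq'; have mQ : measurable_fun setT (fun z => (q z)%:R%:E : \bar R).
    exact: measurable_bool_natrE.
  have mqv : measurable_fun setT
      (fun v => (q (flip_stat (xsign e.1) b v))%:R%:E : \bar R).
    by apply: (measurableT_comp mQ); exact: measurable_flip_stat.
  rewrite /init_law fubini_tonelli1//; last exact: mH.
  under eq_integral => x _.
    rewrite /fubini_F; under eq_integral do rewrite /H/= EFinM.
    rewrite ge0_integralZl//; last by rewrite lee_fin mulr_ge0// ltW.
    rewrite (ge0_integral_flip_stat _ _ (fun z => (q z)%:R%:E))//.
    over.
  rewrite ge0_integralZr//; last 3 first.
  - by apply/measurable_EFinP; exact: measurable_funM.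
  - by move=> x _; rewrite lee_fin mulr_ge0// ltW.
  - by have /andP[] := integral_bool_le1 _ mq'.
  congr (_ * _)%E; under eq_integral do rewrite EFinM.
  rewrite ge0_integralZl//.
  - exact/measurable_EFinP.
  - by move=> x _; rewrite lee_fin.
  - by rewrite lee_fin ltW.
(* Disjointness of the quadrants identifies them with the positive and negative parts. *)
have q01 z : quadrant z -> quadrant (neg z) -> False.
  by move=> /andP[/andP[h _] _] /andP[/andP[]]; rewrite /= oppr_gt0 => /(lt_trans h); rewrite ltxx.
rewrite integralE.
have -> : (\int[init_law]_w (fun w => (pdot (parity_theta a b w)
    (clarke_min_grad (node_margin e) w))%:E)^\+ w = \int[init_law]_w H quadrant w)%E.
  apply: eq_integral => w _; rewrite funeposE ntk_integrand// -EFin_max; congr EFin.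
  rewrite -/(S w) -/(neg (S w)); have := q01 (S w).
  case: (quadrant _) => [/(_ isT)|_]; case: (quadrant _) => //=.
  - by move=> /(_ isT).
  - by rewrite subr0 !mulr1 max_l// mulr_ge0// ltW.
  - by rewrite sub0r mulr0 mulrN mulr1 max_r// oppr_le0 mulr_ge0// ltW.
  - by rewrite subrr mulr0 maxxx.
have -> : (\int[init_law]_w (fun w => (pdot (parity_theta a b w)
    (clarke_min_grad (node_margin e) w))%:E)^\- w =
    \int[init_law]_w H (fun z => quadrant (neg z)) w)%E.
  apply: eq_integral => w _; rewrite funenegE ntk_integrand// -EFinN -EFin_max; congr EFin.
  rewrite -/(S w) -/(neg (S w)); have := q01 (S w).
  case: (quadrant _) => [/(_ isT)|_]; case: (quadrant _) => //=.
  - by move=> /(_ isT).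
  - by rewrite subr0 mulr0 mulr1 max_r// oppr_le0 mulr_ge0// ltW.
  - by rewrite sub0r mulrN opprK !mulr1 max_l// mulr_ge0// ltW.
  - by rewrite subrr mulr0 oppr0 maxxx.
rewrite (HE _ mq) (HE _ mqn) [X in (_ * X - _)%E]quadrant_diff.
have /andP[n0 n1] := integral_bool_le1 _ mqn.
set X := (s%:E * _)%E; set Y := (\int[N]_u _)%E in n0 n1 *.
set Z := (\int[N]_u _)%E.
have X0 : (0 <= X)%E.
  by apply: mule_ge0; [rewrite lee_fin ltW|apply: integral_ge0 => x _; rewrite lee_fin].
have Z0 : (0 <= Z)%E.
  by apply: integral_ge0 => u _; apply: integral_ge0 => t _; rewrite lee_fin.
have Xfin : X \is a fin_num.
  apply: fin_numM => //.
  rewrite ge0_fin_numE; last by apply: integral_ge0 => x _; rewrite lee_fin.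
  apply: (@le_lt_trans _ _ (\int[normal_law (0 : R) 1]_x cst 1 x)%E).
    apply: ge0_le_integral => //.
    - by move=> x _; rewrite lee_fin.
    - exact/measurable_EFinP.
    - by move=> x _; rewrite lee_fin.
  by rewrite integral_cst// mul1e [X in (X < _)%E]probability_setT ltry.
clearbody X Y Z.
(* The common term cancels in the extended reals because it is finite. *)
have Yfin : Y \is a fin_num by rewrite ge0_fin_numE// (le_lt_trans n1)// ltry.
by rewrite ge0_muleDr// addeAC subee ?add0e// fin_numM.
Qed.

End parity_margin.

(** * Margins *)

(** With [t ^+ 2 = 2], the three lower bounds multiply to [81 / 3200] over the dimension, and
    [81 / 3200 > 1 / 50]. *)
Lemma ntk_expectation_ge (R : realType) (m : nat) (a b : 'I_m.+2)
    (e : 'rV[R]_m.+2 * R) :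
  hypercube e.1 -> e.2 = m.+2%:R * e.1 ord0 a * e.1 ord0 b ->
  ((1 / (50 * m.+2%:R))%:E <=
   'E_init_law[fun w => pdot (parity_theta a b w) (clarke_min_grad (node_margin e) w)])%E.
Proof.
move=> hx ey; rewrite ntk_expectation//.
pose p : R := Num.sqrt m.+2%:R; pose t : R := Num.sqrt 2.
have p0 : 0 < p by rewrite sqrtr_gt0 ltr0n.
have t0 : 0 < t by rewrite sqrtr_gt0.
have p2 : m.+2%:R = p ^+ 2 by rewrite sqr_sqrtr.
have t2 : t ^+ 2 = 2 by rewrite sqr_sqrtr.
suff key (X Y Z : \bar R) : ((3 / (8 * t))%:E <= X)%E ->
    ((9 / (40 * (t * p)))%:E <= Y)%E -> ((3 / 5)%:E * Y <= Z)%E ->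
    ((1 / (50 * m.+2%:R))%:E <= (p^-1)%:E * X * Z)%E.
  exact: key abs_normal_law_ge (cone_ge m) (cone_trunc_ge m).
move=> A K P.
apply: (@le_trans _ _ ((p^-1)%:E * (3 / (8 * t))%:E *
    ((3 / 5)%:E * (9 / (40 * (t * p)))%:E))%E).
  rewrite -!EFinM lee_fin p2.
  rewrite [leRHS](_ : _ = 81 / (1600 * t ^+ 2) / p ^+ 2); last first.
    by field; rewrite !gt_eqF.
  rewrite t2 [leLHS](_ : _ = 1 / 50 / p ^+ 2); last by field; rewrite gt_eqF.
  rewrite ler_pM2r ?invr_gt0 ?exprn_gt0//; lra.
apply: lee_pmul.
- by rewrite -EFinM lee_fin mulr_ge0// ?invr_ge0 ?divr_ge0 ?mulr_ge0// ltW.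
- by rewrite -EFinM lee_fin mulr_ge0// divr_ge0// !mulr_ge0// ltW.
- by rewrite lee_wpmul2l// lee_fin invr_ge0 ltW.
- by apply: le_trans P; rewrite lee_wpmul2l.
Qed.

Lemma relu_addN (R : realType) (z : R) : relu z + relu (- z) = `|z|.
Proof.
rewrite /relu; have [z0|z0] := leP 0 z.
  by rewrite ger0_norm// max_l ?oppr_le0// addr0.
by rewrite ltr0_norm// max_r ?add0r// oppr_ge0 ltW.
Qed.

(** * A four-neuron network for the parity *)

Section global_parity.
Context {R : realType} {d : nat}.
Variables a b : 'I_d.

Definition pair_dir (c : R) : 'rV[R]_d :=
  (Num.sqrt 2)^-1 *: (delta_mx ord0 a + c *: delta_mx ord0 b).

Definition parity_alpha (k : 'I_4) : R := if (k < 2)%N then 4^-1 else - 4^-1.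

(** The indices [0, 1] carry the two opposite unit vectors along [e_a + e_b], and [2, 3] those along
    [e_a - e_b]; each pair of ReLUs adds up to an absolute value. *)
Definition parity_beta (k : 'I_4) : 'rV[R]_d :=
  (-1) ^+ k *: pair_dir (if (k < 2)%N then 1 else -1).

Lemma dot_pair_dir c (x : 'rV[R]_d) :
  dot (pair_dir c) x = (Num.sqrt 2)^-1 * (x ord0 a + c * x ord0 b).
Proof. by rewrite dotZl dotDl dotZl !dot_delta. Qed.

Lemma norm2_parity_beta k : a != b -> norm2 (parity_beta k) = 1.
Proof.
move=> ab; rewrite /norm2 /parity_beta; set c := if _ then _ else _.
have c2 : c * c = 1 by rewrite /c; case: ifP; rewrite ?mulr1// mulrNN mulr1.
have t2 : Num.sqrt 2 * Num.sqrt 2 = 2 :> R by rewrite -expr2 sqr_sqrtr.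
have t0 : Num.sqrt 2 != 0 :> R by rewrite gt_eqF// sqrtr_gt0.
rewrite dotZl dotC dotZl mulrA -expr2 -exprM mulnC exprM sqrrN expr1n expr1n mul1r.
rewrite dot_pair_dir !mxE !eqxx (negbTE ab) [b == a]eq_sym (negbTE ab)/=.
rewrite [X in Num.sqrt X](_ : _ = 1) ?sqrtr1//.
transitivity ((1 + c * c) / (Num.sqrt 2 * Num.sqrt 2)); last by rewrite t2 c2; field.
by field.
Qed.

Lemma parity_network (x : 'rV[R]_d) :
  \sum_k parity_alpha k * relu (dot (parity_beta k) x) =
  (4 * Num.sqrt 2)^-1 * (`|x ord0 a + x ord0 b| - `|x ord0 a - x ord0 b|).
Proof.
have t0 : 0 < Num.sqrt 2 :> R by rewrite sqrtr_gt0.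
have dE k : dot (parity_beta k) x =
    (-1) ^+ k * ((Num.sqrt 2)^-1 * (x ord0 a + (if (k < 2)%N then 1 else -1) * x ord0 b)).
  by rewrite dotZl dot_pair_dir.
rewrite 4!big_ord_recl big_ord0 !dE /parity_alpha /=.
have sqrtE y : relu ((Num.sqrt 2)^-1 * y) + relu (- ((Num.sqrt 2)^-1 * y)) =
    (Num.sqrt 2)^-1 * `|y| :> R.
  by rewrite relu_addN normrM gtr0_norm ?invr_gt0.
rewrite /bump/= !exprS expr0 !mulN1r !opprK !mulN1r !mul1r.
have := sqrtE (x ord0 a + x ord0 b); have := sqrtE (x ord0 a - x ord0 b).
move=> hm hp.
rewrite [RHS](_ : _ = 4^-1 * ((Num.sqrt 2)^-1 * `|x ord0 a + x ord0 b| -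
    (Num.sqrt 2)^-1 * `|x ord0 a - x ord0 b|)); last by rewrite invfM; ring.
by rewrite -hm -hp; ring.
Qed.

(** Equality holds: one of [|x_a + x_b|] and [|x_a - x_b|] is [2 / p] and the other [0], the label
    selecting the sign, so the margin is [1 / (2 t p)]. *)
Lemma parity_network_margin (e : 'rV[R]_d * R) : (0 < d)%N ->
  hypercube e.1 -> e.2 = d%:R * e.1 ord0 a * e.1 ord0 b ->
  1 / Num.sqrt (8 * d%:R) <=
  e.2 * \sum_k parity_alpha k * relu (dot (parity_beta k) e.1).
Proof.
move=> d0 hx ey; rewrite parity_network ey.
pose p : R := Num.sqrt d%:R; pose t : R := Num.sqrt 2.
have p0 : 0 < p by rewrite sqrtr_gt0 ltr0n.
have t0 : 0 < t by rewrite sqrtr_gt0.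
have p2 : d%:R = p ^+ 2 by rewrite sqr_sqrtr.
have -> : Num.sqrt (8 * d%:R) = 2 * t * p :> R.
  have -> : 8 * d%:R = (2 * t * p) ^+ 2 :> R.
    by rewrite !exprMn /t sqr_sqrtr// -p2; ring.
  by rewrite sqrtr_sqr ger0_norm// !mulr_ge0// ltW.
rewrite -/t p2.
have pi0 : 0 < p^-1 by rewrite invr_gt0.
have pp : p^-1 + p^-1 = 2 * p^-1 by ring.
have n2 : `|2 * p^-1| = 2 * p^-1 by rewrite gtr0_norm// mulr_gt0.
rewrite le_eqVlt; apply/orP; left; apply/eqP.
have [|] := hx a; have [|] := hx b; rewrite -/p => -> ->;
  rewrite ?opprK ?subrr ?addNr ?pp -?opprD ?pp ?normrN ?n2 ?normr0; field;
  rewrite !gt_eqF//.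
Qed.

End global_parity.

Theorem proposition1p8 (R : realType) (d : nat) (hd : (2 <= d)%N)
    (a b : 'I_d) (hab : a != b) (D : probability ('rV[R]_d * R)%type R)
    (hD : parity_data a b D) :
  (exists gamma_ntk : R,
     1 / (50 * d%:R) <= gamma_ntk /\ dist_ntk_margin D gamma_ntk) /\
  (exists gamma_gl : R,
     1 / Num.sqrt (8 * d%:R) <= gamma_gl /\ dist_global_margin D gamma_gl).
Proof.
have d0 : (0 < d)%N by exact: ltn_trans hd.
split.
- exists (1 / (50 * d%:R)); split => //; exists (parity_theta a b) => n.
  apply: filterS (ae_iid_law D n _ hD) => S hS; split.
  + by rewrite divr_gt0// mulr_gt0// ltr0n.
  + exact: measurable_parity_theta.
  + exact: pnorm2_parity_theta.
  + exact: parity_theta_eq0.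
  + move=> i; have [hx ey] := hS i.
    (* The hypothesis [2 <= d] leaves the dimensions [m.+2], the form in which the Gaussian
       estimates are stated. *)
    case: d hd a b hab D hD d0 S hS hx ey => [|[|m]]// *; exact: ntk_expectation_ge.
- exists (1 / Num.sqrt (8 * d%:R)); split => //.
  exists 4%N, parity_alpha, (parity_beta a b) => n.
  apply: filterS (ae_iid_law D n _ hD) => S hS; split.
  + by rewrite divr_gt0// sqrtr_gt0 mulr_gt0// ltr0n.
  + rewrite 4!big_ord_recl big_ord0 /parity_alpha/= normrN ger0_norm ?invr_ge0//.
    by field.
  + by move=> k; exact: norm2_parity_beta.
  + by move=> i; have [hx ey] := hS i; exact: parity_network_margin.
Qed.
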